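(* Let $p$ be a prime and let $f,u\in\mathcal S_0(\mathbb Z_p)$ be a minimal commuting pair. If $\mathbb Q_p(\pi)/\mathbb Q_p$ is a Galois extension for every $\pi\in\Lambda_f$, then there exists a power series $z\in\mathcal S_0(\mathbb Z_p)$ which is torsion of order $e$ under composition (i.e. $z^{\circ e}(x)=x$ and $z^{\circ j}(x)\neq x$ for $1\le j<e$) and which commutes with both $f$ and $u$ under composition.
   Context: For a commutative ring $R$, $\mathcal S_0(R)=\{g\in R[[x]] : g(0)=0,\ g'(0)\neq 0\}$; $\circ$ denotes composition and $g^{\circ n}$ the $n$-fold iterate. For $g\in\mathbb Z_p[[x]]$, $\bar g\in\mathbb F_p[[x]]$ is its coefficientwise reduction, and $\mathrm{wideg}(g)$ is the least $i$ such that the coefficient of $x^i$ in $\bar g$ is nonzero ($\infty$ if $\bar g=0$). $v_p$ is the valuation on $\overline{\mathbb Q}_p$ with $v_p(p)=1$, and $\mathfrak m^{\mathrm{alg}}$ is the maximal ideal of the integral closure of $\mathbb Z_p$ in $\overline{\mathbb Q}_p$. For $f\in\mathcal S_0(\mathbb Z_p)$ with $f'(0)\notin\mathbb Z_p^\times$, $\Lambda_f(n)=\{\pi\in\mathfrak m^{\mathrm{alg}} : f^{\circ n}(\pi)=0\}$ for $n\ge 0$ and $\Lambda_f=\bigcup_{n\ge0}\Lambda_f(n)$. Let $\delta=1$ if $p>2$ and $\delta=2$ if $p=2$; let $e=p-1$ if $p>2$ and $e=2$ if $p=2$. A minimal commuting pair is a pair $f,u\in\mathcal S_0(\mathbb Z_p)$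 with $f\circ u=u\circ f$, $f'(0)\notin\mathbb Z_p^\times$, $u'(0)\in\mathbb Z_p^\times$, $u$ not torsion under composition ($u^{\circ n}\ne x$ for all $n\ge1$), $\mathrm{wideg}(f)=p$, $v_p(f'(0))=1$ and $v_p(u'(0)-1)=\delta$. *)

(* Defs.v *)
From HB Require Import structures.
From mathcomp Require Import all_boot all_order all_algebra all_field.
From mathcomp Require Import boolp.

Set Implicit Arguments.
Unset Strict Implicit.
Unset Printing Implicit Defensive.

Import GRing.Theory.
Local Open Scope ring_scope.

(* The ring Z_p, as the inverse limit of the Z/p^n: an element is given by its
   residues a_n in [0, p^n), with a_n = a_(n+1) mod p^n.  Primality is a
   parameter of the type because it is needed for Z_p to be a domain. *)
Section PadicIntegers.
Local Open Scope nat_scope.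

Record padic_int (p : nat) (p_pr : prime p) := MkZp {
  zres :> nat -> nat;
  zres_subproof : `[< forall n, zres n = zres n.+1 %% p ^ n >]
}.

Variables (p : nat) (p_pr : prime p).
Local Notation Zp := (padic_int p_pr).

HB.instance Definition _ := [isSub of Zp for @zres p p_pr].
HB.instance Definition _ := [Choice of Zp by <:].

Implicit Types a b c : Zp.

Lemma zresS a n : zres a n = zres a n.+1 %% p ^ n.
Proof. by case: a => x xP /=; move/asboolP: (xP) => <-. Qed.

Lemma zres_ltn a n : zres a n < p ^ n.
Proof. by rewrite zresS ltn_mod expn_gt0 prime_gt0. Qed.

Lemma zres_mod a n : zres a n %% p ^ n = zres a n.
Proof. by rewrite modn_small ?zres_ltn. Qed.

Lemma zres_leq a m n : m <= n -> zres a m = zres a n %% p ^ m.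
Proof.
move=> /subnK <-; elim: (n - m) => [|k IHk]; first by rewrite add0n zres_mod.
by rewrite IHk (zresS a (k + m)) modn_dvdm // dvdn_exp2l // leq_addl.
Qed.

Lemma zp_ext a b : (forall n, zres a n = zres b n) -> a = b.
Proof. by move=> e; apply/val_inj/funext. Qed.

Definition zp_mk_proof (x : nat -> nat) :
  (forall n, x n = x n.+1 %[mod p ^ n]) ->
  `[< forall n, x n %% p ^ n = (x n.+1 %% p ^ n.+1) %% p ^ n >].
Proof.
by move=> xP; apply/asboolP => n; rewrite modn_dvdm ?xP // dvdn_exp2l.
Qed.

Definition zp_mk x (xP : forall n, x n = x n.+1 %[mod p ^ n]) : Zp :=
  MkZp p_pr (zp_mk_proof xP).

Lemma zp_add_proof a b n :
  zres a n + zres b n = zres a n.+1 + zres b n.+1 %[mod p ^ n].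
Proof. by rewrite (zresS a) (zresS b) modnDm. Qed.

Lemma zp_mul_proof a b n :
  zres a n * zres b n = zres a n.+1 * zres b n.+1 %[mod p ^ n].
Proof. by rewrite (zresS a) (zresS b) modnMm. Qed.

Lemma zp_opp_proof a n :
  p ^ n - zres a n = p ^ n.+1 - zres a n.+1 %[mod p ^ n].
Proof.
apply/eqP; rewrite -(eqn_modDr (zres a n.+1)) subnK; last exact/ltnW/zres_ltn.
rewrite -modnDmr -zresS subnK; last exact/ltnW/zres_ltn.
by rewrite modnn expnS modnMl.
Qed.

Definition zp_nat (m : nat) : Zp := @zp_mk (fun=> m) (fun=> erefl).
Definition zp_add a b := zp_mk (zp_add_proof a b).
Definition zp_mul a b := zp_mk (zp_mul_proof a b).
Definition zp_opp a := zp_mk (zp_opp_proof a).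

Fact zp_addA : associative zp_add.
Proof. by move=> a b c; apply: zp_ext => n /=; rewrite modnDml modnDmr addnA. Qed.

Fact zp_addC : commutative zp_add.
Proof. by move=> a b; apply: zp_ext => n /=; rewrite addnC. Qed.

Fact zp_add0 : left_id (zp_nat 0) zp_add.
Proof. by move=> a; apply: zp_ext => n /=; rewrite mod0n zres_mod. Qed.

Fact zp_addN : left_inverse (zp_nat 0) zp_opp zp_add.
Proof.
move=> a; apply: zp_ext => n /=.
by rewrite modnDml subnK ?modnn ?mod0n // ltnW ?zres_ltn.
Qed.

HB.instance Definition _ :=
  GRing.isZmodule.Build Zp zp_addA zp_addC zp_add0 zp_addN.

Fact zp_mulA : associative zp_mul.
Proof. by move=> a b c; apply: zp_ext => n /=; rewrite modnMml modnMmr mulnA. Qed.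

Fact zp_mulC : commutative zp_mul.
Proof. by move=> a b; apply: zp_ext => n /=; rewrite mulnC. Qed.

Fact zp_mul1 : left_id (zp_nat 1) zp_mul.
Proof. by move=> a; apply: zp_ext => n /=; rewrite modnMml mul1n zres_mod. Qed.

Fact zp_mulDl : left_distributive zp_mul zp_add.
Proof.
by move=> a b c; apply: zp_ext => n /=; rewrite modnMml modnDm mulnDl.
Qed.

Fact zp_1neq0 : zp_nat 1 != zp_nat 0.
Proof.
apply/eqP => /(congr1 (fun a => zres a 1)) /=.
by rewrite expn1 mod0n modn_small // prime_gt1.
Qed.

HB.instance Definition _ :=
  GRing.Zmodule_isComNzRing.Build Zp zp_mulA zp_mulC zp_mul1 zp_mulDl zp_1neq0.

Local Open Scope ring_scope.

Definition zp_unit : {pred Zp} := fun a => `[< exists b : Zp, b * a = 1 >].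

Definition zp_inv a : Zp :=
  if pselect (exists b : Zp, b * a = 1) is left h then projT1 (cid h) else a.

Fact zp_mulV : {in zp_unit, left_inverse 1 zp_inv *%R}.
Proof.
move=> a /asboolP aU; rewrite /zp_inv.
by case: pselect => [h|//]; exact: projT2 (cid h).
Qed.

Fact zp_unitPl a b : b * a = 1 -> zp_unit a.
Proof. by move=> ba1; apply/asboolP; exists b. Qed.

Fact zp_inv_out : {in [predC zp_unit], zp_inv =1 id}.
Proof.
move=> a; rewrite inE /= => /asboolPn aNU; rewrite /zp_inv.
by case: pselect.
Qed.

HB.instance Definition _ :=
  GRing.ComNzRing_hasMulInverse.Build Zp zp_mulV zp_unitPl zp_inv_out.

Lemma zp_neq0P a : a != 0 -> exists n, zres a n != 0%N.
Proof.
move=> a0; apply: contrapT => /forallNP a_eq0; case/eqP: a0.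
apply: zp_ext => n /=; rewrite mod0n; apply/eqP.
by have /negP := a_eq0 n; rewrite negbK.
Qed.

Lemma zp_logn a i k : (i <= k)%N -> zres a i != 0%N ->
  (0 < zres a k)%N /\ (logn p (zres a k) < i)%N.
Proof.
move=> ik ai0.
have kpos : (0 < zres a k)%N.
  by rewrite lt0n; apply: contra ai0 => /eqP ak; rewrite (zres_leq _ ik) ak mod0n.
split=> //; rewrite ltnNge -pfactor_dvdn //.
by apply: contra ai0; rewrite (zres_leq _ ik).
Qed.

Fact zp_idomain : GRing.integral_domain_axiom Zp.
Proof.
move=> a b ab0; apply: contrapT => /negP; rewrite negb_or => /andP[].
move=> /zp_neq0P[i ai0] /zp_neq0P[j bj0].
have [apos la] := zp_logn (leq_addr j i) ai0.
have [bpos lb] := zp_logn (leq_addl i j) bj0.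
have /eqP := congr1 (fun c : Zp => zres c (i + j)) ab0.
rewrite /= mod0n -/(dvdn _ _) pfactor_dvdn ?muln_gt0 ?apos //.
by rewrite lognM // leqNgt (leq_trans _ (leq_add la (ltnW lb))).
Qed.

HB.instance Definition _ := GRing.ComUnitRing_isIntegral.Build Zp zp_idomain.
End PadicIntegers.

(* The field Q_p. *)
Notation padic_field p_pr := {fraction padic_int p_pr}.

(* The least index satisfying P; None stands for infinity. *)
Definition least_index (P : pred nat) : option nat :=
  if pselect (exists n, P n) is left h then Some (ex_minn h) else None.

(* v_p on Z_p: the least n such that p^(n+1) does not divide a. *)
Definition vp (p : nat) (p_pr : prime p) (a : padic_int p_pr) : option nat :=
  least_index (fun n => zres a n.+1 != 0%N).

Definition residue (p : nat) (p_pr : prime p) (a : padic_int p_pr) : 'F_p :=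
  (zres a 1)%:R.

(* R[[x]]: the series g is the function sending i to the coefficient of x^i. *)
Definition pseries (R : comNzRingType) := nat -> R.

Section PowerSeries.
Variable R : comNzRingType.
Implicit Types f g : pseries R.

Definition psX : pseries R := fun i => (i == 1%N)%:R.

Definition ps_trunc f n : {poly R} := \poly_(i < n) f i.

(* The composite f o g, for g(0) = 0: the coefficient of x^n then depends only
   on f and g modulo x^(n+1). *)
Definition pscomp f g : pseries R :=
  fun n => (ps_trunc f n.+1 \Po ps_trunc g n.+1)`_n.

Definition psiter g n : pseries R := iter n (pscomp g) psX.

Definition S0 g : Prop := g 0%N = 0 /\ g 1%N != 0.

Definition pscommute f g : Prop := pscomp f g = pscomp g f.

Definition pstorsion_order g e : Prop :=
  psiter g e = psX /\ forall j, (1 <= j < e)%N -> psiter g j <> psX.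

Definition pstorsion g : Prop := exists2 n, (1 <= n)%N & psiter g n = psX.
End PowerSeries.

Arguments psX {R}.

Definition wideg (p : nat) (p_pr : prime p) (g : pseries (padic_int p_pr)) :
  option nat := least_index (fun i => residue (g i) != 0).

Section AlgebraicClosure.
Variables (p : nat) (p_pr : prime p).
Local Notation Zp := (padic_int p_pr).
Local Notation Qp := (padic_field p_pr).
Variables (Omega : closedFieldType) (iota : {rmorphism Qp -> Omega}).

Definition is_algebraic_closure : Prop := forall x, algebraicOver iota x.

Definition zp_incl (a : Zp) : Omega := iota (tofrac a).

Definition integral_closure (x : Omega) : Prop := integralOver zp_incl x.

(* The integral closure is a local ring: its maximal ideal consists of its
   non-units. *)
Definition m_alg (x : Omega) : Prop :=
  integral_closure x /\ ~ (exists2 y, integral_closure y & x * y = 1).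

(* v_p(x) >= N if and only if x / p^N is integral over Z_p, so this is
   convergence for the topology of v_p. *)
Definition padic_cvg (s : nat -> Omega) (l : Omega) : Prop :=
  forall N, exists M, forall n, (M <= n)%N ->
    integral_closure ((s n - l) / p%:R ^+ N).

(* g(x) = l *)
Definition ps_value (g : pseries Zp) (x l : Omega) : Prop :=
  padic_cvg (fun n => \sum_(i < n) zp_incl (g i) * x ^+ i) l.

Definition Lambda_at (f : pseries Zp) (n : nat) (x : Omega) : Prop :=
  m_alg x /\ ps_value (psiter f n) x 0.

Definition Lambda (f : pseries Zp) (x : Omega) : Prop :=
  exists n, Lambda_at f n x.

(* Q_p(x)/Q_p is Galois.  MathComp's Galois theory takes place inside a finite
   normal extension L of the base field; here L is embedded in Omega over Q_p,
   with x in its image.  For x algebraic such an L always exists, and the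
   property does not depend on it. *)
Definition galois_adjoin (x : Omega) : Prop :=
  exists (L : splittingFieldType Qp) (j : {rmorphism L -> Omega}) (y : L),
    [/\ forall a : Qp, j a%:A = iota a, j y = x & galois 1%VS <<1; y>>%VS].
End AlgebraicClosure.

Definition delta_of (p : nat) : nat := if (2 < p)%N then 1 else 2.
Definition e_of (p : nat) : nat := if (2 < p)%N then p.-1 else 2.

Definition minimal_commuting_pair (p : nat) (p_pr : prime p)
    (f u : pseries (padic_int p_pr)) : Prop :=
  [/\ [/\ S0 f, S0 u & pscommute f u],
      [/\ f 1%N \isn't a GRing.unit, u 1%N \is a GRing.unit & ~ pstorsion u],
      wideg f = Some p,
      vp (f 1%N) = Some 1%N
    & vp (u 1%N - 1) = Some (delta_of p)].

(* Main.v *)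
Require Import Defs.
From HB Require Import structures.
From mathcomp Require Import all_boot all_order all_algebra all_field.
From mathcomp Require Import boolp cyclic zify ring.

Set Implicit Arguments.
Unset Strict Implicit.
Unset Printing Implicit Defensive.

Import GRing.Theory.
Local Open Scope ring_scope.

(* Write f = x E and let F_k be the k-th iterate of f; E o F_k is an Eisenstein
   series, so it generates a prime ideal of Z_p[[x]].  If v commutes with f and fixes the zeros
   of F_k, it permutes the at most p zeros of F_(k+1) above each of them, so that
   v^(p!) fixes the zeros of F_(k+1).  Hence F_n divides u^((p!)^n) - x, and
   comparing the derivatives at 0 shows that u is not torsion modulo p.
   Consequently f' = 0 modulo p, i.e. f = h o x^p modulo p with h invertible and
   commuting with f and u modulo p, and only constants are fixed by u modulo p.

   Every series commuting with f and u modulo p lifts to a series w over Z_p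
   commuting with both.  Passing from p^k to p^(k+1) requires solving
   v o f = (f o w - w o f) / p^k modulo p, i.e. that the right-hand side has
   derivative 0; writing f' = p g, this says that g(w) w' / (w'(f) g) = 1 modulo
   p^k, and this ratio is fixed by u modulo p^k, hence constant.

   Let W lift h.  Then k = W^-1 o f is x^p modulo p and k'(0) is p times a unit, so
   Lubin-Tate theory gives a unique series commuting with k with any prescribed
   derivative at 0.  The one whose derivative is a root of unity of order e is the
   required z; uniqueness makes it commute with W, f and u. *)

(** * The ring of power series *)

Section SeriesRing.
Variable R : comNzRingType.
Implicit Types f g h y z : pseries R.

HB.instance Definition _ := gen_eqMixin (pseries R).
HB.instance Definition _ := gen_choiceMixin (pseries R).

Definition ps_zero : pseries R := fun=> 0.
Definition ps_opp f : pseries R := fun n => - f n.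
Definition ps_add f g : pseries R := fun n => f n + g n.
Definition psC (c : R) : pseries R := fun n => if n is 0 then c else 0.
Definition ps_mul f g : pseries R :=
  fun n => \sum_(i < n.+1) f i * g (n - i)%N.

Fact ps_addA : associative ps_add.
Proof. by move=> f g h; apply/funext => n; exact: addrA. Qed.
Fact ps_addC : commutative ps_add.
Proof. by move=> f g; apply/funext => n; exact: addrC. Qed.
Fact ps_add0 : left_id ps_zero ps_add.
Proof. by move=> f; apply/funext => n; exact: add0r. Qed.
Fact ps_addN : left_inverse ps_zero ps_opp ps_add.
Proof. by move=> f; apply/funext => n; exact: addNr. Qed.

HB.instance Definition _ :=
  GRing.isZmodule.Build (pseries R) ps_addA ps_addC ps_add0 ps_addN.

Lemma coef_trunc f m n : (n < m)%N -> (ps_trunc f m)`_n = f n.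
Proof. by move=> nm; rewrite coef_poly nm. Qed.

(** The coefficient of x^n involves only coefficients of index at most n, so the ring axioms for
    series are inherited from polynomials through truncation. *)
Lemma coef_trunc_mul f g m n :
  (n < m)%N -> (ps_trunc f m * ps_trunc g m)`_n = ps_mul f g n.
Proof.
move=> nm; rewrite coefM; apply: eq_bigr => i _.
have im : (i < m)%N by apply: leq_ltn_trans nm; rewrite -ltnS.
by rewrite !coef_trunc // (leq_ltn_trans _ nm) // leq_subr.
Qed.

Fact ps_mulA : associative ps_mul.
Proof.
move=> f g h; apply/funext => n.
transitivity ((ps_trunc f n.+1 * (ps_trunc g n.+1 * ps_trunc h n.+1))`_n).
  rewrite coefM; apply: eq_bigr => i _.
  by rewrite coef_trunc // coef_trunc_mul // ltnS leq_subr.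
rewrite mulrA coefM; apply: eq_bigr => i _.
by rewrite coef_trunc_mul // coef_trunc // ltnS leq_subr.
Qed.

Fact ps_mulC : commutative ps_mul.
Proof.
by move=> f g; apply/funext => n; rewrite -!(coef_trunc_mul _ _ (ltnSn n)) mulrC.
Qed.

Fact ps_mul1 : left_id (psC 1) ps_mul.
Proof.
move=> f; apply/funext => n; rewrite /ps_mul big_ord_recl mul1r subn0.
by rewrite big1 ?addr0 // => i _; rewrite mul0r.
Qed.

Fact ps_mulDl : left_distributive ps_mul ps_add.
Proof.
move=> f g h; apply/funext => n; rewrite /ps_add /ps_mul -big_split /=.
by apply: eq_bigr => i _; rewrite mulrDl.
Qed.

Fact ps_1neq0 : psC 1 != 0.
Proof.
apply/eqP => /(congr1 (fun f : pseries R => f 0%N)) /= /eqP.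
by rewrite oner_eq0.
Qed.

HB.instance Definition _ :=
  GRing.Zmodule_isComNzRing.Build (pseries R) ps_mulA ps_mulC ps_mul1 ps_mulDl
    ps_1neq0.

Lemma ps1E n : (1 : pseries R) n = (n == 0%N)%:R. Proof. by case: n. Qed.
Lemma psDE f g n : (f + g) n = f n + g n. Proof. by []. Qed.
Lemma psBE f g n : (f - g) n = f n - g n. Proof. by []. Qed.
Lemma psME f g n : (f * g) n = \sum_(i < n.+1) f i * g (n - i)%N.
Proof. by []. Qed.

Lemma psM0 f g : (f * g) 0%N = f 0%N * g 0%N.
Proof. by rewrite psME big_ord1. Qed.

Lemma psM1 f g : (f * g) 1%N = f 0%N * g 1%N + f 1%N * g 0%N.
Proof. by rewrite psME !big_ord_recl big_ord0 addr0. Qed.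

Lemma ps_sumE I (r : seq I) P (F : I -> pseries R) n :
  (\sum_(i <- r | P i) F i) n = \sum_(i <- r | P i) F i n.
Proof. by elim/big_rec2: _ => // i x y _ <-. Qed.

Fact psC_is_zmod : zmod_morphism psC.
Proof.
by move=> a b; apply/funext => -[|n] //=; rewrite psBE subr0.
Qed.
Fact psC_is_monoid : monoid_morphism psC.
Proof.
split=> // a b; apply/funext => n; rewrite psME big_ord_recl /= subn0.
rewrite big1 ?addr0 => [|i _]; last by rewrite mul0r.
by case: n => //= n; rewrite mulr0.
Qed.
HB.instance Definition _ := GRing.isZmodMorphism.Build R (pseries R) psC psC_is_zmod.
HB.instance Definition _ := GRing.isMonoidMorphism.Build R (pseries R) psC psC_is_monoid.

Lemma psCM c f n : (psC c * f) n = c * f n.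
Proof.
rewrite psME big_ord_recl /= subn0 big1 ?addr0 // => i _.
by rewrite mul0r.
Qed.

Lemma psX0 f : (psX * f) 0%N = 0.
Proof. by rewrite psM0 mul0r. Qed.

Lemma psXS f n : (psX * f) n.+1 = f n.
Proof.
rewrite psME !big_ord_recl /= /psX /= mul0r add0r mul1r /bump /= subSS subn0.
by rewrite big1 ?addr0 // => i _; rewrite mul0r.
Qed.

Lemma psXnE m f n : (psX ^+ m * f) n = if (n < m)%N then 0 else f (n - m)%N.
Proof.
elim: m n => [|m IHm] n; first by rewrite expr0 mul1r subn0.
rewrite exprS -mulrA; case: n => [|n]; first exact: psX0.
by rewrite psXS IHm ltnS subSS.
Qed.

Lemma psX_coef m n : (psX ^+ m : pseries R) n = (n == m)%:R.
Proof.
rewrite -[psX ^+ m]mulr1 psXnE ps1E subn_eq0.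
by case: ltngtP.
Qed.

Lemma psXn_neq0 m : psX ^+ m != 0 :> pseries R.
Proof.
apply/eqP => /(congr1 (fun f : pseries R => f m)) /eqP.
by rewrite psX_coef eqxx oner_eq0.
Qed.

Lemma psX_inj : injective (fun f => psX * f).
Proof.
by move=> f g /= fg; apply/funext => n; rewrite -psXS fg psXS.
Qed.

(** This is (f - f(0)) / x, the usual step [s] in the applications of [ps_coind]. *)
Definition psshift f : pseries R := fun n => f n.+1.

Lemma psshiftE f : f = psC (f 0%N) + psX * psshift f.
Proof.
apply/funext => -[|n]; rewrite psDE ?psX0 ?addr0 // psXS.
by rewrite add0r.
Qed.

Lemma psX_dvd f : f 0%N = 0 -> f = psX * psshift f.
Proof. by move=> f0; rewrite {1}[f]psshiftE f0 rmorph0 add0r. Qed.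

(* Two solutions of the same recursion T i = y * T (s i) with y(0) = 0 are
   equal: this replaces all arguments by x-adic continuity. *)
Lemma ps_coind (I : Type) (T : I -> pseries R) (y : I -> pseries R)
    (s : I -> I) :
  (forall i, y i 0%N = 0) -> (forall i, T i = y i * T (s i)) ->
  forall i, T i = 0.
Proof.
move=> y0 TE i; apply/funext => n; elim/ltn_ind: n i => n IHn i.
rewrite TE psME big1 // => -[[|j] jn] _ /=; first by rewrite y0 mul0r.
by rewrite IHn ?mulr0 // ltn_subrL /=; move: jn; case: (n).
Qed.

Lemma exp_coef0 y m n : y 0%N = 0 -> (n < m)%N -> (y ^+ m) n = 0.
Proof.
by move=> /psX_dvd -> nm; rewrite exprMn psXnE nm.
Qed.

(** * Evaluation and composition *)

(* The value at y, with y(0) = 0, of a series whose coefficients are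
   themselves series. *)
Definition pseval (G : nat -> pseries R) (y : pseries R) : pseries R :=
  fun n => (\sum_(i < n.+1) G i * y ^+ i) n.

Lemma pseval_widen G y n m : y 0%N = 0 -> (n < m)%N ->
  pseval G y n = (\sum_(i < m) G i * y ^+ i) n.
Proof.
move=> y0 nm; rewrite /pseval -!(big_mkord xpredT (fun i => G i * y ^+ i)).
rewrite (big_cat_nat (leq0n n.+1) nm) /= psDE.
rewrite [X in _ = _ + X](_ : _ = 0) ?addr0 //.
rewrite ps_sumE big_nat_cond big1 // => i.
rewrite andbT => /andP[ni _]; rewrite mulrC psME big1 // => j _.
by rewrite exp_coef0 ?mul0r // (leq_trans (ltn_ord j)).
Qed.

(** Horner's rule. It brings evaluation into the form required by [ps_coind], so that most later
    identities reduce to ring computations. *)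
Lemma pseval_rec G y : y 0%N = 0 ->
  pseval G y = G 0%N + y * pseval (fun i => G i.+1) y.
Proof.
move=> y0; apply/funext => n; rewrite {1}/pseval big_ord_recl !psDE mulr1.
congr (_ + _); transitivity ((y * \sum_(i < n) G i.+1 * y ^+ i) n).
  rewrite mulr_sumr; congr (fun f : pseries R => f n).
  by apply: eq_bigr => i _; rewrite mulrCA exprS.
rewrite !psME !big_ord_recl y0 !mul0r; congr (_ + _).
apply: eq_bigr => -[i lin] _ /=; rewrite (@pseval_widen _ y _ n) //.
by case: n lin => // n _; rewrite subSS ltnS leq_subr.
Qed.

Lemma pseval_coef0 G y : y 0%N = 0 -> pseval G y 0%N = G 0%N 0%N.
Proof. by move=> y0; rewrite pseval_rec // psDE psM0 y0 mul0r addr0. Qed.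

Lemma pscompE f g : pscomp f g = pseval (fun i => psC (f i)) g.
Proof.
apply/funext => n; rewrite /pscomp comp_polyE coef_sum.
have coefX m i : (i <= n)%N -> ((ps_trunc g n.+1) ^+ m)`_i = (g ^+ m) i.
  elim: m i => [|m IHm] i iln; first by rewrite !expr0 coef1 ps1E.
  rewrite !exprS coefM psME; apply: eq_bigr => j _.
  have jn : (j <= n)%N by apply: leq_trans iln; rewrite -ltnS.
  by rewrite coef_trunc ?ltnS // IHm // (leq_trans (leq_subr _ _)).
rewrite /pseval ps_sumE.
rewrite -(big_mkord xpredT (fun i => ((ps_trunc f n.+1)`_i *: ps_trunc g n.+1 ^+ i)`_n)).
rewrite -(big_mkord xpredT (fun i => (psC (f i) * g ^+ i) n)).
have sz : (size (ps_trunc f n.+1) <= n.+1)%N by exact: size_poly.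
rewrite [RHS](big_cat_nat (leq0n _) sz) //=.
rewrite [X in _ = _ + X]big_nat_cond [X in _ = _ + X]big1 ?addr0; last first.
  move=> i; rewrite andbT => /andP[si ni].
  by rewrite psCM -(coef_trunc f ni) (nth_default _ si) mul0r.
rewrite [LHS]big_nat_cond [RHS]big_nat_cond; apply: eq_bigr => i.
rewrite andbT => /andP[_ si].
by rewrite coefZ psCM coefX // coef_trunc // (leq_trans si).
Qed.

Lemma pscomp_rec f y : y 0%N = 0 ->
  pscomp f y = psC (f 0%N) + y * pscomp (psshift f) y.
Proof. by move=> y0; rewrite !pscompE pseval_rec. Qed.

Lemma pscomp_coef0 f y : y 0%N = 0 -> pscomp f y 0%N = f 0%N.
Proof. by move=> y0; rewrite pscompE pseval_coef0. Qed.

Lemma pscomp_coef1 f y : y 0%N = 0 -> pscomp f y 1%N = f 1%N * y 1%N.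
Proof.
move=> y0; rewrite pscomp_rec // psDE psM1 y0 mul0r !add0r.
by rewrite pscomp_coef0 // mulrC.
Qed.

Lemma pscompB f g y : pscomp (f - g) y = pscomp f y - pscomp g y.
Proof.
rewrite !pscompE; apply/funext => n.
rewrite psBE /pseval -psBE -sumrB; congr (fun f : pseries R => f n).
by apply: eq_bigr => i _; rewrite psBE rmorphB mulrBl.
Qed.

Lemma pscompD f g y : pscomp (f + g) y = pscomp f y + pscomp g y.
Proof.
by apply/eqP; rewrite -subr_eq -pscompB addrK.
Qed.

Lemma pscompC c y : y 0%N = 0 -> pscomp (psC c) y = psC c.
Proof.
move=> y0; rewrite pscomp_rec // [psshift _](_ : _ = 0).
  by rewrite -[0](subrr 0) pscompB subrr mulr0 addr0.
by apply/funext.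
Qed.

Lemma pscompM f g y : y 0%N = 0 ->
  pscomp (f * g) y = pscomp f y * pscomp g y.
Proof.
move=> y0; apply/eqP; rewrite -subr_eq0; apply/eqP.
apply: (ps_coind (T := fun f => pscomp (f * g) y - pscomp f y * pscomp g y)
                 (y := fun=> y) (s := psshift)) => // {}f /=.
have -> : f * g = psC (f 0%N) * g + psX * (psshift f * g).
  by rewrite {1}[f]psshiftE mulrDl mulrA.
have cC c h : pscomp (psC c * h) y = psC c * pscomp h y.
  apply/funext => n; rewrite !pscompE psCM /pseval -psCM mulr_sumr.
  by congr (fun f : pseries R => f n); apply: eq_bigr => i _; rewrite psCM rmorphM mulrA.
have cX h : pscomp (psX * h) y = y * pscomp h y.
  rewrite pscomp_rec // psX0 rmorph0 add0r; congr (_ * pscomp _ _).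
  by apply/funext => n; rewrite /psshift psXS.
rewrite pscompD cC cX (pscomp_rec f) //.
ring.
Qed.

Lemma pscompX y : y 0%N = 0 -> pscomp psX y = y.
Proof.
move=> y0; rewrite pscomp_rec // (_ : psshift psX = psC 1).
  by rewrite pscompC // mulr1 rmorph0 add0r.
by apply/funext => -[|n].
Qed.

Lemma pscompx f : pscomp f psX = f.
Proof.
apply/funext => n; rewrite pscompE /pseval ps_sumE big_ord_recr /= psCM.
have -> : (psX ^+ n : pseries R) n = 1 by rewrite -[psX ^+ n]mulr1 psXnE ltnn subnn.
rewrite mulr1 big1 ?add0r // => i _; rewrite psCM.
rewrite -[psX ^+ i]mulr1 psXnE ltnNge ltnW // ps1E /=.
by rewrite subn_eq0 leqNgt ltn_ord mulr0.
Qed.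

Lemma pscomp1 y : y 0%N = 0 -> pscomp 1 y = 1.
Proof. exact: pscompC. Qed.

Lemma pscompXn f n y : y 0%N = 0 -> pscomp (f ^+ n) y = pscomp f y ^+ n.
Proof.
move=> y0; elim: n => [|n IHn]; first by rewrite !expr0 pscomp1.
by rewrite !exprS pscompM // IHn.
Qed.

Lemma pscompA f g h : g 0%N = 0 -> h 0%N = 0 ->
  pscomp f (pscomp g h) = pscomp (pscomp f g) h.
Proof.
move=> g0 h0; have gh0 : pscomp g h 0%N = 0 by rewrite pscomp_coef0.
apply/eqP; rewrite -subr_eq0; apply/eqP.
apply: (ps_coind (T := fun f => pscomp f (pscomp g h) - pscomp (pscomp f g) h)
          (y := fun=> pscomp g h) (s := psshift)) => // {}f /=.
rewrite (pscomp_rec f) // (pscomp_rec f g0) pscompD pscompM // pscompC //.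
ring.
Qed.

(** * Derivatives *)

Definition psderiv f : pseries R := fun n => f n.+1 *+ n.+1.

Lemma psderivD f g : psderiv (f + g) = psderiv f + psderiv g.
Proof. by apply/funext => n; rewrite /psderiv !psDE mulrnDl. Qed.

Lemma psderivC c : psderiv (psC c) = 0.
Proof. by apply/funext => n; rewrite /psderiv mul0rn. Qed.

Lemma psderivCM c f : psderiv (psC c * f) = psC c * psderiv f.
Proof. by apply/funext => n; rewrite psCM /psderiv psCM mulrnAr. Qed.

Lemma psderivXM f : psderiv (psX * f) = f + psX * psderiv f.
Proof.
apply/funext => n; rewrite /psderiv psXS psDE mulrS; congr (_ + _).
by case: n => [|n]; rewrite ?psX0 // psXS.
Qed.

Lemma psderiv_shift f : psderiv f = psshift f + psX * psderiv (psshift f).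
Proof. by rewrite {1}[f]psshiftE psderivD psderivC add0r psderivXM. Qed.

Lemma psderivM f g : psderiv (f * g) = psderiv f * g + f * psderiv g.
Proof.
apply/eqP; rewrite -subr_eq0; apply/eqP.
apply: (ps_coind (T := fun f => psderiv (f * g) - (psderiv f * g + f * psderiv g))
          (y := fun=> psX) (s := psshift)) => // {}f /=.
have -> : f * g = psC (f 0%N) * g + psX * (psshift f * g).
  by rewrite {1}[f]psshiftE mulrDl mulrA.
rewrite psderivD psderivCM psderivXM.
rewrite (psderiv_shift f).
have -> : f * psderiv g = (psC (f 0%N) + psX * psshift f) * psderiv g.
  by rewrite -psshiftE.
ring.
Qed.

Lemma psderiv_comp f y : y 0%N = 0 ->
  psderiv (pscomp f y) = pscomp (psderiv f) y * psderiv y.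
Proof.
move=> y0; apply/eqP; rewrite -subr_eq0; apply/eqP.
apply: (ps_coind (T := fun f => psderiv (pscomp f y)
                                - pscomp (psderiv f) y * psderiv y)
          (y := fun=> y) (s := psshift)) => // {}f /=.
rewrite pscomp_rec // psderivD psderivC psderivM.
rewrite (psderiv_shift f).
rewrite pscompD pscompM // pscompX //.
ring.
Qed.

(** * Divided differences *)

(* The quotient (G(Y) - G(y)) / (Y - y), as a series in Y. *)
Definition psdivdiff (G : nat -> pseries R) (y : pseries R) :
  nat -> pseries R := fun m => pseval (fun i => G (m + i).+1) y.

Lemma psdivdiffE G y z : y 0%N = 0 -> z 0%N = 0 ->
  pseval G z - pseval G y = (z - y) * pseval (psdivdiff G y) z.
Proof.
move=> y0 z0; apply/eqP; rewrite -subr_eq0; apply/eqP.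
apply: (ps_coind
  (T := fun G => pseval G z - pseval G y - (z - y) * pseval (psdivdiff G y) z)
  (y := fun=> z) (s := fun G i => G i.+1)) => // {}G /=.
rewrite (pseval_rec G z0) (pseval_rec G y0) (pseval_rec (psdivdiff G y) z0).
have -> : psdivdiff G y 0%N = pseval (fun i => G i.+1) y by [].
have -> : (fun i => psdivdiff G y i.+1) = psdivdiff (fun i => G i.+1) y by [].
ring.
Qed.

Lemma psdivdiff_coef0 G y m : y 0%N = 0 ->
  psdivdiff G y m 0%N = G m.+1 0%N.
Proof. by move=> y0; rewrite /psdivdiff pseval_coef0 // addn0. Qed.

Lemma psdivdiff_deriv f y : y 0%N = 0 ->
  pseval (psdivdiff (fun i => psC (f i)) y) y = pscomp (psderiv f) y.
Proof.
move=> y0; apply/eqP; rewrite -subr_eq0; apply/eqP.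
apply: (ps_coind
  (T := fun f => pseval (psdivdiff (fun i => psC (f i)) y) y
                 - pscomp (psderiv f) y)
  (y := fun=> y) (s := psshift)) => // {}f /=.
rewrite pseval_rec // {1}/psdivdiff /=.
rewrite (psderiv_shift f).
rewrite pscompD pscompM // pscompX // [pscomp (psshift f) y]pscompE.
rewrite /psshift.
ring.
Qed.

Definition psdiff f y z := pseval (psdivdiff (fun i => psC (f i)) y) z.

Lemma psdiffE f y z : y 0%N = 0 -> z 0%N = 0 ->
  pscomp f z - pscomp f y = (z - y) * psdiff f y z.
Proof. by move=> y0 z0; rewrite !pscompE psdivdiffE. Qed.

(** A divided difference of the divided difference supplies the factor (z - y)^2; the diagonal value
    of the first one is the derivative. *)
Lemma ps_taylor f y z : y 0%N = 0 -> z 0%N = 0 ->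
  exists h, pscomp f z = pscomp f y + pscomp (psderiv f) y * (z - y)
                         + (z - y) ^+ 2 * h.
Proof.
move=> y0 z0; set G := psdivdiff (fun i => psC (f i)) y.
exists (pseval (psdivdiff G y) z).
have := psdiffE f y0 z0; rewrite /psdiff -/G.
have := psdivdiffE G y0 z0; rewrite {2}/G psdivdiff_deriv // -/G.
move=> /eqP; rewrite subr_eq => /eqP -> /eqP; rewrite subr_eq => /eqP ->.
ring.
Qed.

End SeriesRing.

(** * Congruences, units and inverses *)

Section Congruence.
Variable R : comNzRingType.
Implicit Types d f g h y z : pseries R.

Definition pscong d f g := exists h, f = g + d * h.

Lemma pscong_refl d f : pscong d f f.
Proof. by exists 0; rewrite mulr0 addr0. Qed.

Lemma pscong_sym d f g : pscong d f g -> pscong d g f.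
Proof. by case=> h ->; exists (- h); ring. Qed.

Lemma pscong_trans d f g h : pscong d f g -> pscong d g h -> pscong d f h.
Proof. by case=> a -> [b ->]; exists (a + b); ring. Qed.

Lemma pscong_sub0 d f g : pscong d (f - g) 0 <-> pscong d f g.
Proof.
split=> -[h]; last by move=> ->; exists h; ring.
by move=> /eqP; rewrite subr_eq => /eqP ->; exists h; ring.
Qed.

Lemma pscongM d f1 g1 f2 g2 :
  pscong d f1 g1 -> pscong d f2 g2 -> pscong d (f1 * f2) (g1 * g2).
Proof.
by case=> a -> [b ->]; exists (a * g2 + g1 * b + d * a * b); ring.
Qed.

Lemma pscong_dvd d e f g : pscong (d * e) f g -> pscong d f g.
Proof. by case=> h ->; exists (e * h); ring. Qed.

Lemma pscong_comp d f y z : y 0%N = 0 -> z 0%N = 0 ->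
  pscong d y z -> pscong d (pscomp f y) (pscomp f z).
Proof.
move=> y0 z0 [h yz]; exists (h * psdiff f z y).
apply/eqP; rewrite addrC -subr_eq psdiffE // yz; apply/eqP; ring.
Qed.

Lemma pscong_compl d f g y : y 0%N = 0 ->
  pscong d f g -> pscong (pscomp d y) (pscomp f y) (pscomp g y).
Proof. by move=> y0 [h ->]; exists (pscomp h y); rewrite pscompD pscompM. Qed.

Lemma pscomp_nat m y : y 0%N = 0 -> pscomp m%:R y = m%:R.
Proof. by move=> y0; rewrite -(rmorph_nat (@psC R)) pscompC. Qed.

Lemma psderiv_natM m f : psderiv (m%:R * f) = m%:R * psderiv f.
Proof. by rewrite -(rmorph_nat (@psC R)) psderivCM. Qed.

Lemma psnatME m f n : (m%:R * f) n = m%:R * f n.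
Proof. by rewrite -(rmorph_nat (@psC R)) psCM. Qed.

Lemma pscong_compl_nat m f g y : y 0%N = 0 ->
  pscong m%:R f g -> pscong m%:R (pscomp f y) (pscomp g y).
Proof. by move=> y0 /(pscong_compl y0); rewrite pscomp_nat. Qed.

Lemma pscong_deriv_nat m f g :
  pscong m%:R f g -> pscong m%:R (psderiv f) (psderiv g).
Proof.
by case=> h ->; exists (psderiv h); rewrite psderivD psderiv_natM.
Qed.

Lemma pscong_coef_nat m f g n :
  pscong m%:R f g -> exists c, f n = g n + m%:R * c.
Proof. by case=> h ->; exists (h n); rewrite psDE psnatME. Qed.

Lemma pscompA' f g y : g 0%N = 0 -> y 0%N = 0 ->
  pscomp (pscomp f g) y = pscomp f (pscomp g y).
Proof. by move=> g0 y0; rewrite pscompA. Qed.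

Definition psgeom : pseries R := fun=> 1.

Lemma psgeomE : (1 - psX) * psgeom = 1.
Proof.
rewrite mulrBl mul1r; apply/funext => -[|n]; rewrite psBE ps1E.
  by rewrite psX0 subr0.
by rewrite psXS subrr.
Qed.

(** With y = 1 - c f, which vanishes at 0, the inverse of c f = 1 - y is the geometric series in
    y. *)
Lemma ps_inv c f : c * f 0%N = 1 -> exists g, g * f = 1.
Proof.
move=> cf; set y : pseries R := 1 - psC c * f.
have y0 : y 0%N = 0 by rewrite /y psBE psCM cf subrr.
exists (pscomp psgeom y * psC c); rewrite -mulrA.
have -> : psC c * f = pscomp (1 - psX) y.
  by rewrite pscompB pscompX // pscomp1 // /y; ring.
by rewrite mulrC -pscompM // psgeomE pscomp1.
Qed.

(** Coefficients are chosen one after the other; settling coefficient n does not disturb the earlier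
    conditions, as condition m reads only coefficients of index at most m. *)
Lemma ps_triangular (P : pseries R -> nat -> Prop) :
  (forall f g n, (forall i, (i <= n)%N -> f i = g i) -> P f n -> P g n) ->
  (forall f n, (forall m, (m < n)%N -> P f m) ->
     exists c : R, P (fun i => if i == n then c else f i) n) ->
  exists f, forall n, P f n.
Proof.
move=> Pext Pex.
pose upd f n c : pseries R := fun i => if i == n then c else f i.
have step f n : {c | (forall m, (m < n)%N -> P f m) -> P (upd f n c) n}.
  apply: cid; have [Pf|nP] := pselect (forall m, (m < n)%N -> P f m).
    by have [c Pc] := Pex _ _ Pf; exists c.
  by exists 0.
(* The coefficients of [S n] below n are final; the solution is the diagonal of these
   approximations. *)
pose fix S n : pseries R := if n is m.+1 then upd (S m) m (sval (step (S m) m))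
                            else 0.
have Slt n k i : (i < n)%N -> S (n + k)%N i = S n i.
  move=> lt_in; elim: k => [|k IHk]; first by rewrite addn0.
  rewrite addnS /= /upd ifN ?IHk //.
  by rewrite ltn_eqF // (leq_trans lt_in) // leq_addr.
have Seq m n i : (i < m)%N -> (m <= n)%N -> S n i = S m i.
  by move=> im /subnKC <-; exact: Slt.
pose f : pseries R := fun n => S n.+1 n.
exists f => n; elim/ltn_ind: n => n IHn.
have PS : P (S n.+1) n.
  apply: (svalP (step (S n) n)) => m mn.
  by apply: Pext (IHn m mn) => i im; rewrite /f -(Seq i.+1 n i) // (leq_trans _ mn).
by apply: Pext PS => i il; rewrite /f (Seq i.+1 n.+1).
Qed.

Lemma expX_coef y n : y 0%N = 0 -> (y ^+ n) n = y 1%N ^+ n.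
Proof.
move=> y0; rewrite {1}(psX_dvd y0) exprMn psXnE ltnn subnn.
elim: n => [|n IHn]; first by rewrite !expr0.
by rewrite !exprS psM0 IHn.
Qed.

Lemma pscomp_coefS f y n : y 0%N = 0 ->
  pscomp f y n = pscomp (fun i => if (i < n)%N then f i else 0) y n
                 + f n * y 1%N ^+ n.
Proof.
move=> y0; rewrite !pscompE /pseval !ps_sumE !big_ord_recr /= !psCM ltnn.
rewrite expX_coef // mul0r addr0; congr (_ + _).
by apply: eq_bigr => i _; rewrite ltn_ord.
Qed.

Lemma pscomp_coef_ext f g y n :
  (forall i, (i <= n)%N -> f i = g i) -> pscomp f y n = pscomp g y n.
Proof.
move=> fg; rewrite !pscompE /pseval !ps_sumE; apply: eq_bigr => i _.
by rewrite fg // -ltnS.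
Qed.

(** The system is triangular: coefficient n of [f] enters coefficient n of [pscomp f y] with the
    invertible factor y'(0)^n. *)
Lemma ps_linv c y : y 0%N = 0 -> c * y 1%N = 1 ->
  exists f, [/\ f 0%N = 0, f 1%N = c & pscomp f y = psX].
Proof.
move=> y0 cy.
have [f fP] : exists f, forall n, pscomp f y n = psX n.
  apply: (ps_triangular (P := fun f n => pscomp f y n = psX n)).
    by move=> f g n fg <-; apply: pscomp_coef_ext => i /fg.
  move=> f n _; set f0 : pseries R := fun i => if (i < n)%N then f i else 0.
  exists ((psX n - pscomp f0 y n) * c ^+ n).
  rewrite pscomp_coefS // eqxx -mulrA -exprMn cy expr1n mulr1.
  rewrite -[RHS](subrK (pscomp f0 y n)) addrC; congr (_ + pscomp _ _ _).
  by apply/funext => i; rewrite /f0; case: ltngtP.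
have fX : pscomp f y = psX by apply/funext.
exists f; split=> //; first by rewrite -(pscomp_coef0 f y0) fX.
rewrite -[f 1%N]mulr1 -cy mulrCA -(pscomp_coef1 f y0) fX.
by rewrite /psX mulr1.
Qed.

(** The left inverse [f] of [y] has itself a left inverse, which must equal [y]. *)
Lemma ps_compinv c y : y 0%N = 0 -> c * y 1%N = 1 ->
  exists f, [/\ f 0%N = 0, f 1%N = c, pscomp f y = psX & pscomp y f = psX].
Proof.
move=> y0 cy; have [f [f0 f1 fy]] := ps_linv y0 cy.
have [g [g0 _ gf]] : exists g, [/\ g 0%N = 0, g 1%N = y 1%N & pscomp g f = psX].
  by apply: ps_linv; rewrite // f1 mulrC.
exists f; split=> //; rewrite -[y in pscomp y f](pscompX y0) -gf.
by rewrite -(pscompA g) // fy pscompx.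
Qed.

End Congruence.

(** * Iterates *)

Section Iterates.
Variable R : comNzRingType.
Implicit Types f g h y z : pseries R.

Lemma psiter_coef0 g n : g 0%N = 0 -> psiter g n 0%N = 0.
Proof. by move=> g0; elim: n => //= n IHn; rewrite pscomp_coef0. Qed.

Lemma psiter_coef1 g n : g 0%N = 0 -> psiter g n 1%N = g 1%N ^+ n.
Proof.
move=> g0; elim: n => //= n IHn.
by rewrite pscomp_coef1 ?IHn ?exprS ?psiter_coef0.
Qed.

Lemma psiterS g n : psiter g n.+1 = pscomp g (psiter g n). Proof. by []. Qed.

Lemma psiterD g m n : g 0%N = 0 ->
  psiter g (m + n) = pscomp (psiter g m) (psiter g n).
Proof.
move=> g0; elim: m => [|m IHm]; first by rewrite pscompX // psiter_coef0.
by rewrite addSn !psiterS IHm pscompA // psiter_coef0.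
Qed.

Lemma psiter1 g : psiter g 1 = g. Proof. exact: pscompx. Qed.

Lemma psiterSr g n : g 0%N = 0 -> psiter g n.+1 = pscomp (psiter g n) g.
Proof. by move=> g0; rewrite -addn1 psiterD // psiter1. Qed.

Lemma psiterM g m n : g 0%N = 0 -> psiter g (n * m) = psiter (psiter g m) n.
Proof.
move=> g0; elim: n => //= n IHn.
by rewrite mulSn psiterD // IHn.
Qed.

Lemma pscommute_iter f g n : f 0%N = 0 -> g 0%N = 0 ->
  pscommute f g -> pscommute f (psiter g n).
Proof.
rewrite /pscommute => f0 g0 fg; elim: n => [|n IHn].
  by rewrite pscompx pscompX.
by rewrite psiterS pscompA ?psiter_coef0 // fg -!pscompA ?psiter_coef0 // IHn.
Qed.

Lemma pscommute_comp f g h : f 0%N = 0 -> g 0%N = 0 -> h 0%N = 0 ->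
  pscommute f g -> pscommute f h -> pscommute f (pscomp g h).
Proof.
rewrite /pscommute => f0 g0 h0 fg fh.
by rewrite pscompA // fg -!pscompA // fh.
Qed.

Lemma pscong_iter d g n y z : g 0%N = 0 -> y 0%N = 0 -> z 0%N = 0 ->
  pscong d y z -> pscong d (pscomp (psiter g n) y) (pscomp (psiter g n) z).
Proof. by move=> g0 y0 z0 yz; apply: pscong_comp. Qed.

Lemma pscong_iter_id d g n : g 0%N = 0 ->
  pscong d g psX -> pscong d (psiter g n) psX.
Proof.
move=> g0 dg; elim: n => [|n IHn]; first exact: pscong_refl.
rewrite psiterS; apply: pscong_trans dg; rewrite -[X in pscong _ _ X]pscompx.
by apply: pscong_comp => //; exact: psiter_coef0.
Qed.

End Iterates.

(** * Reduction of the coefficients *)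

Section Map.
Variables (R S : comNzRingType) (phi : {rmorphism R -> S}).
Implicit Types f g : pseries R.

Definition psmap f : pseries S := fun n => phi (f n).

Fact psmap_is_zmod : zmod_morphism psmap.
Proof. by move=> f g; apply/funext => n; rewrite /psmap !psBE rmorphB. Qed.
Fact psmap_is_monoid : monoid_morphism psmap.
Proof.
split; first by apply/funext => -[|n]; rewrite /psmap !ps1E ?rmorph1 ?rmorph0.
move=> f g; apply/funext => n; rewrite /psmap !psME rmorph_sum.
by apply: eq_bigr => i _; rewrite rmorphM.
Qed.
HB.instance Definition _ :=
  GRing.isZmodMorphism.Build (pseries R) (pseries S) psmap psmap_is_zmod.
HB.instance Definition _ :=
  GRing.isMonoidMorphism.Build (pseries R) (pseries S) psmap psmap_is_monoid.

Lemma psmapX : psmap psX = psX.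
Proof. by apply/funext => n; rewrite /psmap /psX rmorph_nat. Qed.

Lemma psmap_comp f g : psmap (pscomp f g) = pscomp (psmap f) (psmap g).
Proof.
apply/funext => n; rewrite !pscompE /psmap /pseval !ps_sumE rmorph_sum.
apply: eq_bigr => i _; rewrite !psCM rmorphM; congr (_ * _).
by rewrite -[RHS]/((psmap g ^+ i) n) -rmorphXn.
Qed.

Lemma psmap_iter g n : psmap (psiter g n) = psiter (psmap g) n.
Proof. by elim: n => [|n IHn]; rewrite ?psmapX // !psiterS psmap_comp IHn. Qed.

Lemma psmap_deriv f : psmap (psderiv f) = psderiv (psmap f).
Proof. by apply/funext => n; rewrite /psmap /psderiv rmorphMn. Qed.

End Map.

(** * Series over a domain *)

Section Domain.
Variable R : idomainType.
Implicit Types f g h y : pseries R.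

Lemma ps_order f : f != 0 -> exists m g, f = psX ^+ m * g /\ g 0%N != 0.
Proof.
move=> f0; have [n fn] : exists n, f n != 0.
  apply: contrapT => /forallNP fn; case/eqP: f0; apply/funext => n.
  by apply/eqP; have /negP := fn n; rewrite negbK.
case: (ex_minnP (ex_intro (fun n => f n != 0) n fn)) => m fm mmin.
exists m, (fun i => f (m + i)%N); split; last by rewrite addn0.
apply/funext => i; rewrite psXnE; case: ltnP => [im|mi]; last by rewrite subnKC.
by apply: contraTeq im => fi0; rewrite -leqNgt mmin.
Qed.

Lemma ps_mul_neq0 f g : f != 0 -> g != 0 -> f * g != 0.
Proof.
move=> /ps_order[m [f1 [-> f10]]] /ps_order[n [g1 [-> g10]]].
apply/eqP => /(congr1 (fun f : pseries R => f (m + n)%N)).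
rewrite mulrACA -exprD psXnE ltnn subnn psM0 => /eqP.
by rewrite mulf_eq0 (negPf f10) (negPf g10).
Qed.

Lemma ps_mulI f g h : f != 0 -> f * g = f * h -> g = h.
Proof.
move=> f0 /eqP; rewrite -subr_eq0 -mulrBr => fgh; apply/eqP.
by rewrite -subr_eq0; apply: contraTT fgh => /(ps_mul_neq0 f0).
Qed.

Lemma ps_comp_neq0 f y : y 0%N = 0 -> y != 0 -> f != 0 -> pscomp f y != 0.
Proof.
move=> y0 yn0 /ps_order[m [g [-> g0]]].
rewrite pscompM // pscompXn // pscompX //; apply: ps_mul_neq0.
  by elim: m => [|m IHm]; rewrite ?expr0 ?oner_eq0 // exprS ps_mul_neq0.
apply: contra_neq g0 => g0; rewrite -(pscomp_coef0 g y0) g0.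
by [].
Qed.

Lemma ps_comp_inj f g y : y 0%N = 0 -> y != 0 ->
  pscomp f y = pscomp g y -> f = g.
Proof.
move=> y0 yn0 /eqP; rewrite -subr_eq0 -pscompB => fgy; apply/eqP.
by rewrite -subr_eq0; apply: contraTT fgy; exact: ps_comp_neq0.
Qed.

End Domain.

(** * The ring Z_p *)

Section PadicFacts.
Variables (p : nat) (p_pr : prime p).
Local Notation Zp := (padic_int p_pr).
Implicit Types a b c : Zp.

Lemma zresD a b n : zres (a + b) n = ((zres a n + zres b n) %% p ^ n)%N.
Proof. by []. Qed.

Lemma zresM a b n : zres (a * b) n = ((zres a n * zres b n) %% p ^ n)%N.
Proof. by []. Qed.

Lemma zresN a n : zres (- a) n = ((p ^ n - zres a n) %% p ^ n)%N.
Proof. by []. Qed.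

Lemma zres0 n : zres (0 : Zp) n = 0%N.
Proof. exact: mod0n. Qed.

Lemma zres_nat m n : zres (m%:R : Zp) n = (m %% p ^ n)%N.
Proof.
elim: m => [|m IHm]; first by rewrite mulr0n zres0 mod0n.
by rewrite mulrS zresD IHm modnDm add1n.
Qed.

Lemma zres_eqP a b k :
  zres a k = zres b k <-> exists c, a = b + p%:R ^+ k * c.
Proof.
have pkM c : zres (p%:R ^+ k * c) k = 0%N.
  by rewrite -natrX zresM zres_nat modnn mul0n mod0n.
split=> [ab|[c ->]]; last by rewrite zresD pkM addn0 zres_mod.
suff dvd c : zres c k = 0%N -> exists d, c = p%:R ^+ k * d.
  have [|d dE] := dvd (a - b).
    by rewrite zresD zresN ab modnDmr subnKC ?modnn // ltnW ?zres_ltn.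
  by exists d; rewrite -dE addrC subrK.
move=> {ab a b pkM} ck.
have pk0 : (0 < p ^ k)%N by rewrite expn_gt0 prime_gt0.
have pkE n : zres c (n + k) = (zres c (n + k) %/ p ^ k * p ^ k)%N.
  rewrite divnK // /dvdn; apply/eqP.
  by rewrite -zres_leq ?leq_addl // ck.
(* The residue of c / p^k modulo p^n is read off the residue of [c] modulo p^(n + k). *)
have dP n : (zres c (n + k) %/ p ^ k = zres c (n.+1 + k) %/ p ^ k %[mod p ^ n])%N.
  apply/eqP; rewrite -(eqn_pmul2r pk0) !muln_modl -expnD -!pkE.
  by rewrite addSn -zresS zres_mod.
exists (zp_mk p_pr dP); apply: zp_ext => n.
rewrite -natrX zresM zres_nat /= modnMml modnMmr mulnC -pkE.
by rewrite -zres_leq ?leq_addr.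
Qed.

Lemma zp_natp_neq0 : (p%:R : Zp) != 0.
Proof.
apply/eqP => /(congr1 (fun a : Zp => zres a 2)); rewrite zres_nat zres0.
by rewrite modn_small ?ltn_exp2l ?(ltn_Pmulr _ _) ?prime_gt1 ?prime_gt0 //;
   case: p p_pr => // -[].
Qed.

Lemma zp_separated a : (forall k, exists c, a = p%:R ^+ k * c) -> a = 0.
Proof.
move=> dvd; apply: zp_ext => k; apply/zres_eqP.
by have [c ->] := dvd k; exists c; rewrite add0r.
Qed.

Lemma zp_complete (s : nat -> Zp) :
  (forall k, exists c, s k.+1 = s k + p%:R ^+ k * c) ->
  exists a, forall k, exists c, a = s k + p%:R ^+ k * c.
Proof.
move=> sP; have sE k : zres (s k) k = zres (s k.+1) k.
  by apply/esym/zres_eqP.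
have aP k : (zres (s k) k = zres (s k.+1) k.+1 %[mod p ^ k])%N.
  by rewrite -zresS sE zres_mod.
exists (zp_mk p_pr aP) => k; apply/zres_eqP.
by rewrite /= zres_mod.
Qed.

Fact residue_is_zmod : zmod_morphism (@residue p p_pr).
Proof.
move=> a b; apply/eqP; rewrite eq_sym subr_eq /residue -natrD.
by rewrite -{1}(subrK b a) zresD expn1 Fp_nat_mod.
Qed.
Fact residue_is_monoid : monoid_morphism (@residue p p_pr).
Proof.
split=> [|a b].
  by rewrite /residue -[X in zres X _]/(1%:R : Zp) zres_nat expn1 Fp_nat_mod.
by rewrite /residue -natrM zresM expn1 Fp_nat_mod.
Qed.
HB.instance Definition _ :=
  GRing.isZmodMorphism.Build Zp 'F_p (@residue p p_pr) residue_is_zmod.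
HB.instance Definition _ :=
  GRing.isMonoidMorphism.Build Zp 'F_p (@residue p p_pr) residue_is_monoid.

Lemma residue_eq0 a : residue a = 0 <-> zres a 1 = 0%N.
Proof.
rewrite /residue; split=> [/eqP|-> //]; rewrite -(dvdn_pcharf (pchar_Fp p_pr)).
by have := zres_ltn a 1; rewrite expn1 => lt /dvdn_leq; case: zres lt => // n nlt /(_ isT);
   rewrite leqNgt nlt.
Qed.

Lemma residue_dvdP a : residue a = 0 <-> exists b, a = p%:R * b.
Proof.
split=> [/residue_eq0 a1|[b ->]].
  have [|b ->] := (zres_eqP a 0 1).1; first by rewrite zres0.
  by exists b; rewrite expr1 add0r.
by rewrite rmorphM rmorph_nat pchar_Fp_0 // mul0r.
Qed.

Lemma residue_surj (c : 'F_p) : exists a, residue a = c.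
Proof.
exists (c : nat)%:R; rewrite rmorph_nat.
by rewrite natr_Zp.
Qed.

(** Modulo p^n the inverse is a power of the residue, by Euler's theorem; uniqueness of inverses
    makes these residues compatible. *)
Lemma residue_unit a : residue a != 0 -> exists b, b * a = 1.
Proof.
move=> ra; have a1 : zres a 1 != 0%N.
  by apply: contra_neq ra => /residue_eq0.
have cop n : coprime (zres a n) (p ^ n).
  case: n => [|n]; first by rewrite coprimen1.
  rewrite coprime_pexpr // coprime_sym prime_coprime //.
  by have := zres_leq a (ltn0Sn n); rewrite expn1 /dvdn => <-.
pose b n := (zres a n ^ (totient (p ^ n)).-1)%N.
have bE n : (b n * zres a n = 1 %[mod p ^ n])%N.
  rewrite -expnSr prednK ?totient_gt0 ?expn_gt0 ?prime_gt0 //.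
  exact: Euler_exp_totient.
have bP n : (b n = b n.+1 %[mod p ^ n])%N.
  have e : (b n.+1 * zres a n = 1 %[mod p ^ n])%N.
    rewrite zresS modnMmr -(modn_dvdm (b n.+1 * _) (dvdn_exp2l p (leqnSn n))).
    by rewrite bE modn_dvdm // dvdn_exp2l.
  rewrite -[LHS]modn_mod -[b n]muln1 -modnMmr -e modnMmr modn_mod.
  by rewrite mulnCA -modnMmr bE modnMmr muln1.
exists (zp_mk p_pr bP); apply: zp_ext => n /=.
by rewrite modnMml bE.
Qed.

Lemma residue_unitP a : (a \is a GRing.unit) = (residue a != 0).
Proof.
apply/idP/idP => [aU|/residue_unit[b ba]]; first by rewrite -unitfE rmorph_unit.
by apply/unitrPr; exists b; rewrite mulrC.
Qed.

Lemma least_index_Some (P : pred nat) n : least_index P = Some n ->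
  P n /\ forall m, (m < n)%N -> ~~ P m.
Proof.
rewrite /least_index; case: pselect => // h [<-].
case: ex_minnP => m Pm mmin; split=> // k km.
by apply: contraL km => /mmin; rewrite leqNgt.
Qed.

Lemma vp_Some a k : vp a = Some k ->
  exists b, a = p%:R ^+ k * b /\ residue b != 0.
Proof.
move=> /least_index_Some[ak amin].
have [b ab] : exists b, a = p%:R ^+ k * b.
  have [|b ->] := (zres_eqP a 0 k).1; last by exists b; rewrite add0r.
  case: k {ak} amin => [|k] amin; first by have := zres_ltn a 0; case: zres.
  by apply/eqP; have := amin k (ltnSn k); rewrite negbK => /eqP ->; rewrite zres0.
exists b; split=> //; apply: contra_neq ak => /residue_dvdP[c bc].
rewrite ab bc mulrA -exprSr -(zres0 k.+1); apply/zres_eqP.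
by exists c; rewrite add0r.
Qed.

End PadicFacts.

(** * Reduction modulo p *)

Section Reduction.
Variables (p : nat) (p_pr : prime p).
Local Notation Zp := (padic_int p_pr).
Implicit Types f g h y : pseries Zp.

Definition psred : pseries Zp -> pseries 'F_p := psmap (@residue p p_pr).

HB.instance Definition _ := GRing.RMorphism.on psred.

Lemma psred_coef f n : psred f n = residue (f n). Proof. by []. Qed.

Lemma psred_congP f g : psred f = psred g <-> pscong p%:R f g.
Proof.
split=> [fg|[h ->]]; last first.
  apply/eqP; rewrite -subr_eq0 -rmorphB addrAC subrr add0r.
  rewrite rmorphM rmorph_nat -(rmorph_nat (@psC _)).
  by rewrite pchar_Fp_0 // rmorph0 mul0r.
have fgP n : exists c, f n - g n = p%:R * c.
  apply/residue_dvdP; rewrite rmorphB; apply/eqP; rewrite subr_eq0; apply/eqP.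
  exact: (congr1 (fun f : pseries 'F_p => f n) fg).
have [h hP] := choice fgP; exists h; apply/funext => n; rewrite psDE psnatME -hP.
by rewrite addrC subrK.
Qed.

Lemma psred_surj (t : pseries 'F_p) : exists f, psred f = t.
Proof.
by have [f fP] := choice (fun n => residue_surj p_pr (t n)); exists f; apply/funext.
Qed.

Lemma ps_natp_neq0 k : (p%:R ^+ k : pseries Zp) != 0.
Proof.
apply/eqP => /(congr1 (fun f : pseries Zp => f 0%N)).
rewrite -natrX -(rmorph_nat (@psC _)) /= natrX => /eqP.
by rewrite expf_eq0 (negPf (zp_natp_neq0 p_pr)) andbF.
Qed.

Lemma ps_unit f : residue (f 0%N) != 0 -> exists g, g * f = 1.
Proof. by move=> /residue_unit[b bf]; apply: (ps_inv (c := b)). Qed.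

Lemma pscong_complete (s : nat -> pseries Zp) :
  (forall k, pscong (p%:R ^+ k) (s k.+1) (s k)) ->
  exists f, forall k, pscong (p%:R ^+ k) f (s k).
Proof.
move=> sP; have lim n : exists a, forall k, exists c, a = s k n + p%:R ^+ k * c.
  apply: zp_complete => k.
  have := sP k; rewrite -natrX => /(pscong_coef_nat n)[c ->]; exists c.
  by rewrite natrX.
have [f fP] := choice lim; exists f => k; have [h hP] := choice (fun n => fP n k).
exists h; apply/funext => n; rewrite hP psDE -!natrX psnatME.
by [].
Qed.

Lemma pscong_separated f g : (forall k, pscong (p%:R ^+ k) f g) -> f = g.
Proof.
move=> fg; apply/funext => n; apply/eqP; rewrite -subr_eq0; apply/eqP.
apply: zp_separated => k; have := fg k.
rewrite -natrX => /(pscong_coef_nat n)[c ->]; exists c.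
by rewrite addrAC subrr add0r natrX.
Qed.

End Reduction.

(** * Frobenius and p-th powers of series over F_p *)

Section FpSeries.
Variables (p : nat) (p_pr : prime p).
Implicit Types t h : pseries 'F_p.

Lemma psXp0 : (psX ^+ p : pseries 'F_p) 0%N = 0.
Proof. by rewrite psX_coef; case: p p_pr. Qed.

(** Additivity of Frobenius and c^p = c on the constant term give both sides the same recursion,
    with step [psshift] and factor x^p. *)
Lemma ps_frobenius t : t ^+ p = pscomp t (psX ^+ p).
Proof.
apply/eqP; rewrite -subr_eq0; apply/eqP.
apply: (ps_coind (T := fun t => t ^+ p - pscomp t (psX ^+ p))
          (y := fun=> psX ^+ p) (s := @psshift _)) => [_|{}t /=]; first exact: psXp0.
rewrite (pscomp_rec t psXp0) {1}[t]psshiftE.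
have pC : p \in [pchar pseries 'F_p].
  apply/andP; split=> //; rewrite -(rmorph_nat (@psC 'F_p)).
  by rewrite pchar_Fp_0 // rmorph0.
rewrite -!(pFrobenius_autE pC) pFrobenius_autD_comm; last exact: mulrC.
rewrite pFrobenius_autM_comm; last exact: mulrC.
rewrite !pFrobenius_autE -rmorphXn /=.
have -> : t 0%N ^+ p = t 0%N by rewrite -[X in _ ^+ X](card_Fp p_pr) expf_card.
ring.
Qed.

(** The factor n in the derivative of x^n is invertible in F_p unless p divides n. *)
Lemma ps_deriv0 t : psderiv t = 0 -> exists h, t = pscomp h (psX ^+ p).
Proof.
move=> dt; have tn n : ~~ (p %| n)%N -> t n = 0.
  case: n => [|n] pn; first by rewrite dvdn0 in pn.
  have /eqP := congr1 (fun f : pseries 'F_p => f n) dt.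
  rewrite /psderiv -mulr_natr mulf_eq0 => /orP[/eqP //|].
  by rewrite -(dvdn_pcharf (pchar_Fp p_pr)) (negPf pn).
have p0 := prime_gt0 p_pr.
exists (fun n => t (p * n)%N); apply/funext => n.
rewrite pscompE /pseval ps_sumE.
under eq_bigr => i _ do rewrite psCM -exprM psX_coef.
have [pn|pn] := boolP (p %| n)%N.
  have qn : (n %/ p < n.+1)%N by rewrite ltnS leq_div.
  rewrite (bigD1 (Ordinal qn)) //= mulnC divnK // eqxx mulr1.
  rewrite big1 ?addr0 // => i; rewrite -val_eqE /= => iq.
  case: eqP => [ni|_]; last by rewrite mulr0.
  by have := congr1 (divn^~ p) ni; rewrite mulKn // => e; rewrite e eqxx in iq.
rewrite big1 ?tn // => i _; case: eqP => [ni|_]; last by rewrite mulr0.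
by case/negP: pn; apply/dvdnP; exists i; rewrite mulnC.
Qed.

End FpSeries.

(** * Eisenstein series *)

Section Eisenstein.
Variables (p : nat) (p_pr : prime p).
Local Notation Zp := (padic_int p_pr).
Implicit Types f g h y : pseries Zp.

(** By Weierstrass preparation these are the units times Eisenstein polynomials; the quotient of
    Z_p[[x]] by such a series is a discrete valuation ring with uniformizer x. *)
Definition eisenstein (E : pseries Zp) : Prop :=
  (exists a, E 0%N = p%:R * a /\ residue a != 0) /\ psred E != 0.

Variable E : pseries Zp.
Hypothesis EE : eisenstein E.

Lemma eisenstein_coef0 : residue (E 0%N) = 0.
Proof. by apply/residue_dvdP; have [[a [-> _]] _] := EE; exists a. Qed.

Lemma eisenstein_decomp : exists A B N,
  [/\ E = p%:R * A + psX ^+ N.+1 * B, residue (A 0%N) != 0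
    & residue (B 0%N) != 0].
Proof.
have [[a [E0 a0]] rE] := EE.
have [N [b [rEb b0]]] := ps_order rE.
have [B Bb] := psred_surj p_pr b.
case: N => [|N] in rEb.
  case/eqP: b0; have := congr1 (fun t : pseries 'F_p => t 0%N) rEb.
  by rewrite expr0 mul1r psred_coef eisenstein_coef0 => <-.
have /psred_congP[A EA] : psred E = psred (psX ^+ N.+1 * B).
  by rewrite rEb rmorphM rmorphXn /= /psred psmapX -/(psred B) Bb.
exists A, B, N; split.
- by rewrite addrC.
- have := congr1 (fun t : pseries Zp => t 0%N) EA.
  rewrite psDE psnatME psXnE add0r E0 => /(mulfI (zp_natp_neq0 p_pr)) <-.
  by [].
- by rewrite -psred_coef Bb.
Qed.

(* Modulo E, the prime p is a unit times a power of x; trading p for it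
   repeatedly turns every series into a multiple of E or into a power of x
   times a unit. *)
Lemma eisenstein_div f : pscong E f 0 \/
  exists m w, pscong E f (psX ^+ m * w) /\ residue (w 0%N) != 0.
Proof.
have [A [B [N [EAB /ps_unit[A' A'A] _]]]] := eisenstein_decomp.
have [pd pdP] : exists pd : Zp -> Zp, forall a, residue a = 0 -> a = p%:R * pd a.
  suff dvd (a : Zp) : exists b, residue a = 0 -> a = p%:R * b.
    by have [pd pdP] := choice dvd; exists pd.
  by have [/residue_dvdP[b ab]|na] := pselect (residue a = 0); [exists b|exists 0].
(* Modulo [E], p = - x^(N + 1) B A'. A constant term divisible by p is rewritten in this way and one
   factor x is taken out. *)
pose next g := psshift g - psX ^+ N * B * A' * psC (pd (g 0%N)).
have nextE g : residue (g 0%N) = 0 ->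
    g = E * A' * psC (pd (g 0%N)) + psX * next g.
  move=> /pdP g0; rewrite {1}[g]psshiftE {1}g0 rmorphM rmorph_nat.
  rewrite /next EAB.
  rewrite -[p%:R in LHS]mulr1 -A'A exprS; ring.
pose c i := iter i next f.
(* If the process never stops, f = E A' D, where [D] collects the successive quotients; otherwise
   the first [c m] with unit constant term is the required [w]. *)
have [all0|] := pselect (forall i, residue (c i 0%N) = 0).
  left; pose D i : pseries Zp := fun j => pd (c (i + j)%N 0%N).
  have DE i : D i = psC (pd (c i 0%N)) + psX * D i.+1.
    rewrite {1}[D i]psshiftE {1}/D addn0; congr (_ + _ * _).
    by apply/funext => j; rewrite /psshift /D addnS addSn.
  exists (A' * D 0%N); rewrite add0r mulrA; apply/eqP; rewrite -subr_eq0; apply/eqP.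
  apply: (ps_coind (T := fun i => c i - E * A' * D i) (y := fun=> psX) (s := S)) => // i.
  rewrite DE {1}(nextE (c i)) // /c /=; ring.
move=> /existsNP ex; right.
have ex' : exists i, residue (c i 0%N) != 0 by case: ex => i /eqP; exists i.
case: (ex_minnP ex') => m cm cmin; exists m, (c m); split=> //.
have : forall i, (i < m)%N -> residue (c i 0%N) = 0.
  by move=> i im; apply/eqP; apply: contraLR im => /cmin; rewrite -leqNgt.
elim: m {cm cmin} => [|m IHm] lt0.
  by rewrite expr0 mul1r; exact: pscong_refl.
have [|h hE] := IHm; first by move=> i im; apply: lt0; apply: ltnW.
exists (h + psX ^+ m * A' * psC (pd (c m 0%N))).
rewrite {1}hE {1}(nextE (c m)) ?lt0 // exprS /c /=; ring.
Qed.

(** Since E(0) is nonzero, x divides the cofactor and can be cancelled. At m = 0 a unit would be a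
    multiple of [E], whose constant term is divisible by p. *)
Lemma eisenstein_ndvd_X m w : residue (w 0%N) != 0 -> ~ pscong E (psX ^+ m * w) 0.
Proof.
move=> w0 [h]; rewrite add0r; elim: m h => [|m IHm] h.
  rewrite expr0 mul1r => wE; case/eqP: w0.
  by rewrite wE psM0 rmorphM /= eisenstein_coef0 mul0r.
rewrite exprS -mulrA => e.
have h0 : h 0%N = 0.
  have := congr1 (fun t : pseries Zp => t 0%N) e; rewrite psX0 psM0 => /esym/eqP.
  have [[a [-> a0]] _] := EE.
  rewrite !mulf_eq0 (negPf (zp_natp_neq0 p_pr)) /=.
  by case/orP => /eqP // a_0; rewrite a_0 rmorph0 eqxx in a0.
apply: (IHm (psshift h)); apply: (@psX_inj _) => /=.
by rewrite e mulrCA -psX_dvd.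
Qed.

(** If [E] divided neither factor, the product would be a power of x times a unit modulo [E]. *)
Lemma eisenstein_prime f g :
  pscong E (f * g) 0 -> pscong E f 0 \/ pscong E g 0.
Proof.
move=> fg; have [|[m [w [fw w0]]]] := eisenstein_div f; first by left.
have [|[n [w' [gw w'0]]]] := eisenstein_div g; first by right.
case: (@eisenstein_ndvd_X (m + n) (w * w')).
  by rewrite psM0 rmorphM mulf_neq0.
apply: pscong_trans fg; apply: pscong_sym.
have -> : psX ^+ (m + n) * (w * w') = (psX ^+ m * w) * (psX ^+ n * w').
  by rewrite exprD; ring.
exact: pscongM.
Qed.

(** If p a = E h, then p divides [h] because [E] is nonzero modulo p; after cancelling p, the unit
    [a] would be a multiple of [E]. *)
Lemma eisenstein_ndvd_p a : residue a != 0 -> ~ pscong E (psC (p%:R * a)) 0.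
Proof.
move=> a0 [h]; rewrite add0r rmorphM rmorph_nat => e.
have [rE] : psred E != 0 by case: EE.
have rh : psred h = 0.
  apply: (ps_mulI rE); rewrite -rmorphM -e mulr0.
  transitivity (psred (0 : pseries Zp)); last exact: rmorph0.
  by apply/psred_congP; exists (psC a); rewrite add0r.
have /psred_congP[h' hE] : psred h = psred (0 : pseries Zp) by rewrite rh; exact/esym/rmorph0.
rewrite hE add0r mulrCA in e.
have p0 : (p%:R : pseries Zp) != 0 by rewrite -[p%:R]expr1 ps_natp_neq0.
have /(congr1 (fun t : pseries Zp => t 0%N)) /= aE := ps_mulI p0 e.
by case/eqP: a0; rewrite aE psM0 rmorphM /= eisenstein_coef0 mul0r.
Qed.

(* A series of Weierstrass degree m has at most m roots modulo E: divide by
   Y - y_0, Y - y_1, ... successively. *)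
Lemma eisenstein_roots m (G : nat -> pseries Zp) (y : nat -> pseries Zp) :
  (forall i, y i 0%N = 0) -> residue (G m 0%N) != 0 ->
  (forall i, (i <= m)%N -> pscong E (pseval G (y i)) 0) ->
  exists i j, (i < j <= m)%N /\ pscong E (y j) (y i).
Proof.
elim: m G y => [|m IHm] G y y0 Gm Gy.
  have [h] := Gy 0%N isT; rewrite add0r => /(congr1 (fun t : pseries Zp => t 0%N)).
  rewrite pseval_coef0 // psM0 => G0; case/eqP: Gm.
  by rewrite G0 rmorphM /= eisenstein_coef0 mul0r.
have [[i [im yi]]|ny] :=
    pselect (exists i, (i <= m)%N /\ pscong E (y i.+1) (y 0%N)).
  by exists 0%N, i.+1.
have [||i im|i [j [/andP[ij jm] yij]]] := IHm (psdivdiff G (y 0%N)) (fun i => y i.+1).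
- by [].
- by rewrite psdivdiff_coef0.
- have : pscong E ((y i.+1 - y 0%N) * pseval (psdivdiff G (y 0%N)) (y i.+1)) 0.
    rewrite -psdivdiffE //; apply/pscong_sub0; apply: pscong_trans (Gy i.+1 _) _ => //.
    exact/pscong_sym/Gy.
  by case/eisenstein_prime=> // /pscong_sub0 yi; case: ny; exists i.
by exists i.+1, j.+1; rewrite !ltnS ij.
Qed.

End Eisenstein.

(** * Fixed points of iterates *)

Section FixedPoints.
Variables (p : nat) (p_pr : prime p).
Local Notation Zp := (padic_int p_pr).
Implicit Types g h v y : pseries Zp.

Variables (f : pseries Zp) (a : Zp).
Hypotheses (f0 : f 0%N = 0) (f1 : f 1%N = p%:R * a) (a0 : residue a != 0).
Hypothesis (fp : residue (f p) != 0).
Local Notation F := (psiter f).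

Let F0 n : F n 0%N = 0. Proof. exact: psiter_coef0. Qed.

Lemma psred_f_neq0 : psred f != 0.
Proof.
by apply: contraNneq fp => /(congr1 (fun t : pseries 'F_p => t p)) e; apply/eqP.
Qed.

Lemma psred_F_neq0 n : psred (F n) != 0.
Proof.
elim: n => [|n IHn].
  apply/eqP => /(congr1 (fun t : pseries 'F_p => t 1%N)) /eqP.
  by rewrite /psred psmapX /= oner_eq0.
rewrite psiterS /psred psmap_comp; apply: ps_comp_neq0 => //.
  by rewrite /psmap F0 rmorph0.
exact: psred_f_neq0.
Qed.

(** This is the quotient F_(k+1) / F_k; its zeros are the zeros of F_(k+1) that are not zeros of
    F_k. *)
Definition Equot k := pscomp (psshift f) (F k).

Lemma F_recE k : F k.+1 = F k * Equot k.
Proof. by rewrite psiterS {1}(psX_dvd f0) pscompM // pscompX. Qed.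

Lemma Equot_eisenstein k : eisenstein (Equot k).
Proof.
split; first by exists a; rewrite /Equot pscomp_coef0.
have := psred_F_neq0 k.+1; rewrite F_recE rmorphM /=; apply: contra_neq => ->.
by rewrite mulr0.
Qed.

(** Modulo F_k the series [Equot k] is its constant term p a; if it divided F_k, it would divide p
    a. *)
Lemma Equot_ndvd_F k : ~ pscong (Equot k) (F k) 0.
Proof.
move=> [h]; rewrite add0r => Fh.
apply: (eisenstein_ndvd_p (Equot_eisenstein k) a0).
exists (1 - h * pscomp (psshift (psshift f)) (F k)).
rewrite add0r mulrBr mulr1 mulrA -Fh {1}/Equot pscomp_rec //.
by rewrite addrK /psshift f1.
Qed.

Lemma psiter_inv g h i : g 0%N = 0 -> h 0%N = 0 -> pscomp g h = psX ->
  pscomp (psiter g i) (psiter h i) = psX.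
Proof.
move=> g0 h0 gh; elim: i => [|i IHi]; first by rewrite pscompX.
rewrite psiterSr // psiterS pscompA' ?pscomp_coef0 ?psiter_coef0 //.
by rewrite (pscompA g) ?psiter_coef0 // gh pscompX ?psiter_coef0.
Qed.

(* v fixes the zeros of F k, hence permutes the at most p zeros of F (k+1)
   above each of them. *)
Lemma fixed_lift v k : v 0%N = 0 -> v 1%N \is a GRing.unit -> pscommute f v ->
  pscong (F k) v psX -> pscong (F k.+1) (psiter v p`!) psX.
Proof.
move=> v0 v1 fv vk; set E := Equot k.
have EE : eisenstein E := Equot_eisenstein k.
have vi0 i : psiter v i 0%N = 0 by exact: psiter_coef0.
(* Since v = x modulo F_k, v(f) = f modulo F_k(f) = F_(k+1), a multiple of [E]. *)
have vf i : pscong E (pscomp (psiter v i) f) f.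
  elim: i => [|i IHi]; first by rewrite pscompX //; exact: pscong_refl.
  rewrite psiterS pscompA' //; apply: (@pscong_trans _ _ _ (pscomp v f)).
    by apply: pscong_comp; rewrite ?pscomp_coef0.
  have Fkf : pscomp (F k) f = E * F k by rewrite -(psiterSr k f0) F_recE mulrC.
  by have := pscong_compl f0 vk; rewrite Fkf (pscompX f0); apply: pscong_dvd.
(* As a series in Y this is f(Y) - f. Its coefficient of Y^p is a unit and the iterates of [v] of
   index 0 to p are roots modulo [E], so two of them coincide there. *)
pose G i : pseries Zp := psC (f i) - f *+ (i == 0%N).
have GE y : y 0%N = 0 -> pseval G y = pscomp f y - f.
  move=> y0; rewrite pseval_rec // (pscomp_rec f) // [pscomp _ y]pscompE /G eqxx.
  have -> : (fun i => psC (f i.+1) - f *+ (i.+1 == 0%N)) = (fun i => psC (psshift f i)).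
    by apply/funext => i; rewrite subr0.
  rewrite mulr1n; ring.
have [||i _|i [j [/andP[ij jp] vij]]] := eisenstein_roots EE (m := p) (G := G) (y := psiter v).
- by [].
- by rewrite /G gtn_eqF ?prime_gt0 // subr0.
- rewrite GE //; apply/pscong_sub0.
  by have -> : pscomp f (psiter v i) = pscomp (psiter v i) f by exact: pscommute_iter.
have [w [w0 _ wv _]] : exists w, [/\ w 0%N = 0, w 1%N = (v 1%N)^-1, pscomp w v = psX & pscomp v w = psX].
  by apply: ps_compinv; rewrite // mulVr.
(* The i-th iterate of [v] is cancelled; what remains has index at most p, hence dividing p!. *)
have vs : pscong E (psiter v (j - i)) psX.
  have := pscong_iter i w0 (vi0 _) (vi0 _) vij.
  rewrite psiter_inv // -{1}(subnKC (ltnW ij)) psiterD // pscompA ?psiter_coef0 //.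
  by rewrite psiter_inv // pscompX.
have dvd_s : (j - i %| p`!)%N.
  by apply: dvdn_fact; rewrite subn_gt0 ij (leq_trans (leq_subr _ _)).
have vE : pscong E (psiter v p`!) psX.
  by rewrite -(divnK dvd_s) psiterM //; apply: pscong_iter_id.
have [b vb] := pscong_iter_id p`! v0 vk.
(* Both F_k and [E] divide the difference of the iterate with x; [E] is prime and does not divide
   F_k, so the product F_(k+1) divides it. *)
have Fb : pscong E (F k * b) 0.
  have := (pscong_sub0 _ _ _).2 vE; rewrite {1}vb => e.
  by rewrite [psX + _]addrC addrK in e.
case: (eisenstein_prime EE Fb) => [/Equot_ndvd_F []|[c bc]].
by exists c; rewrite vb bc add0r mulrA F_recE.
Qed.

(** Modulo p, [f] vanishes to order at least 2 at 0, so each iteration raises the order of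
    vanishing. *)
Lemma psred_F_order n : (forall i, (i < p)%N -> residue (f i) = 0) ->
  exists h : pseries 'F_p, psred (F n) = psX ^+ n.+1 * h.
Proof.
move=> flt; elim: n => [|n [h Fh]].
  by exists 1; rewrite mulr1 expr1 /psred psmapX.
have [g fg] : exists g : pseries 'F_p, psred f = psX ^+ 2 * g.
  exists (fun i => psred f i.+2); apply/funext => i; rewrite psXnE.
  case: ltnP => [i2|]; last by case: i => [|[|i]] //; rewrite subn2.
  by apply: flt; exact: leq_trans i2 (prime_gt1 p_pr).
have rF0 : psred (F n) 0%N = 0 by rewrite psred_coef F0 rmorph0.
exists (psX ^+ n * h ^+ 2 * pscomp g (psred (F n))).
rewrite psiterS /psred psmap_comp -!/(psred _) fg pscompM // pscompXn // pscompX //.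
rewrite {1}Fh !exprS; ring.
Qed.

End FixedPoints.

(** * Growth of the multiplier *)

Lemma expr1D_mod3 (R : comNzRingType) (y : R) n :
  exists d, (1 + y) ^+ n = 1 + n%:R * y + ('C(n, 2))%:R * y ^+ 2 + y ^+ 3 * d.
Proof.
elim: n => [|n [d IHn]]; first by exists 0; rewrite expr0 bin_small //; ring.
exists (d * (1 + y) + ('C(n, 2))%:R); rewrite exprSr IHn.
rewrite binS bin1 natrD -natr1; ring.
Qed.

Lemma prime_ndvd_fact p n : prime p -> (n < p)%N -> ~~ (p %| n`!)%N.
Proof.
move=> p_pr; elim: n => [|n IHn] np; first by rewrite dvdn1 gtn_eqF ?prime_gt1.
by rewrite factS Euclid_dvdM // negb_or gtnNdvd //= IHn // ltnW.
Qed.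

Section Growth.
Variables (p : nat) (p_pr : prime p).
Local Notation Zp := (padic_int p_pr).

Lemma residue_nat n : residue (n%:R : Zp) != 0 = ~~ (p %| n)%N.
Proof. by rewrite rmorph_nat -(dvdn_pcharf (pchar_Fp p_pr)). Qed.

(** The linear term p! p^s b has valuation exactly s + 1. The quadratic one has at least s + 2: for
    odd p because p divides the binomial coefficient, for p = 2 because s is at least 2. The rest
    has at least 3 s. *)
Lemma exp_fact_growth s (b : Zp) : (0 < s)%N -> (p = 2 -> (1 < s)%N) ->
  residue b != 0 ->
  exists c, (1 + p%:R ^+ s * b) ^+ p`! = 1 + p%:R ^+ s.+1 * c /\ residue c != 0.
Proof.
move=> s0 s1 b0; have [d ->] := expr1D_mod3 (p%:R ^+ s * b) p`!.
have pE : p`! = (p * (p.-1)`!)%N by rewrite -{1}(prednK (prime_gt0 p_pr)) factS prednK ?prime_gt0.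
have [e eE] : exists e : Zp, ('C(p`!, 2))%:R * (p%:R ^+ s * b) ^+ 2 = p%:R ^+ s.+2 * e.
  have [p2|pn2] := eqVneq p 2%N.
    exists (('C(p`!, 2))%:R * p%:R ^+ (s - 2) * b ^+ 2).
    have -> : (p%:R ^+ s : Zp) = p%:R ^+ 2 * p%:R ^+ (s - 2) by rewrite -exprD subnKC ?s1.
    have -> : (p%:R ^+ s.+2 : Zp) = p%:R ^+ 2 * p%:R ^+ 2 * p%:R ^+ (s - 2).
      by rewrite -!exprD; congr (_ ^+ _); have := s1 p2; lia.
    ring.
  have /dvdnP[q ->] : (p %| 'C(p`!, 2))%N.
    have : (p %| 2 * 'C(p`!, 2))%N.
      by rewrite mul_bin_left bin1 dvdn_mull // dvdn_fact ?prime_gt0 /=.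
    by rewrite Euclid_dvdM // dvdn_prime2 // (negPf pn2).
  exists (q%:R * p%:R ^+ s.-1 * b ^+ 2).
  have -> : (p%:R ^+ s : Zp) = p%:R * p%:R ^+ s.-1 by rewrite -exprS prednK.
  rewrite natrM !exprS; have -> : (p%:R ^+ s : Zp) = p%:R * p%:R ^+ s.-1 by rewrite -exprS prednK.
  ring.
exists (((p.-1)`!)%:R * b + p%:R * (e + p%:R ^+ (2 * s.-1) * b ^+ 3 * d)); split.
  rewrite eE pE natrM !exprS.
  have -> : (p%:R ^+ s : Zp) = p%:R * p%:R ^+ s.-1 by rewrite -exprS prednK.
  rewrite mulnC exprM; ring.
rewrite rmorphD !rmorphM rmorph_nat /= -[_%:R in X in _ + X]/(p%:R).
rewrite (rmorph_nat _ p) pchar_Fp_0 // mul0r addr0 mulf_neq0 //.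
by rewrite -(rmorph_nat (@residue p p_pr)) residue_nat prime_ndvd_fact // prednK ?prime_gt0.
Qed.

End Growth.

(** * The iterates of u modulo p *)

Section Nontorsion.
Variables (p : nat) (p_pr : prime p).
Local Notation Zp := (padic_int p_pr).
Implicit Types g h v y : pseries Zp.

Variables (f : pseries Zp) (a : Zp).
Hypotheses (f0 : f 0%N = 0) (f1 : f 1%N = p%:R * a) (a0 : residue a != 0).
Hypothesis (fp : residue (f p) != 0).
Hypothesis (flt : forall i, (i < p)%N -> residue (f i) = 0).
Local Notation F := (psiter f).

Variables (u : pseries Zp) (s : nat) (b : Zp).
Hypotheses (u0 : u 0%N = 0) (u1 : u 1%N = 1 + p%:R ^+ s * b).
Hypotheses (b0 : residue b != 0) (s_gt0 : (0 < s)%N) (s_gt1 : p = 2 -> (1 < s)%N).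
Hypotheses (s_le2 : (s <= 2)%N) (fu : pscommute f u).

Definition uiter n := psiter u (p`! ^ n).

Lemma uiterS n : uiter n.+1 = psiter (uiter n) p`!.
Proof. by rewrite /uiter expnS psiterM. Qed.

Lemma uiter0 n : uiter n 0%N = 0. Proof. exact: psiter_coef0. Qed.

Lemma uiter_coef1 n :
  exists c, uiter n 1%N = 1 + p%:R ^+ (n + s) * c /\ residue c != 0.
Proof.
elim: n => [|n [c [uc c0]]]; first by exists b; rewrite /uiter psiter1.
rewrite uiterS psiter_coef1 ?uiter0 // uc; apply: exp_fact_growth => //.
  by rewrite addn_gt0 s_gt0 orbT.
by move=> /s_gt1 s1; apply: leq_trans s1 _; rewrite leq_addl.
Qed.

Lemma uiter_unit n : uiter n 1%N \is a GRing.unit.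
Proof.
have [c [-> _]] := uiter_coef1 n; rewrite residue_unitP rmorphD rmorph1 rmorphM.
rewrite rmorphXn rmorph_nat /= pchar_Fp_0 // expr0n addn_eq0 (gtn_eqF s_gt0).
by rewrite andbF mul0r addr0 oner_eq0.
Qed.

(** One application of [fixed_lift] per level, starting from F_0 = x, which divides u - x. *)
Lemma uiter_fixed n : pscong (F n) (uiter n) psX.
Proof.
elim: n => [|n IHn]; first by exists (psshift (uiter 0) - 1);
  rewrite /= mulrBr mulr1 addrC subrK -psX_dvd ?uiter0.
rewrite uiterS; apply: fixed_lift f0 f1 a0 fp _ _ (uiter0 n) (uiter_unit n) _ IHn.
exact: pscommute_iter.
Qed.

(** If g = x + p^k h, the m-th iterate is x + m p^k h modulo p^(k+1), because [h] changes only by a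
    multiple of p^k under iterates of [g]; and p divides m = p!. *)
Lemma pscong_iter_p k g : (0 < k)%N -> g 0%N = 0 ->
  pscong (p%:R ^+ k) g psX -> pscong (p%:R ^+ k.+1) (psiter g p`!) psX.
Proof.
move=> k0 g0 gX; have [h gE] := gX.
have iE m : exists r, psiter g m = psX + m%:R * (p%:R ^+ k * h) + p%:R ^+ k.+1 * r.
  elim: m => [|m [r IHm]]; first by exists 0; rewrite mul0r mulr0 !addr0.
  have m0 : psiter g m 0%N = 0 by exact: psiter_coef0.
  have [t tE] : pscong (p%:R ^+ k) (pscomp h (psiter g m)) h.
    rewrite -[X in pscong _ _ X]pscompx; apply: pscong_comp => //.
    exact: pscong_iter_id.
  exists (r + p%:R ^+ k.-1 * t); rewrite psiterS {1}gE pscompD pscompM // pscompX //.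
  rewrite -natrX pscomp_nat // natrX tE IHm -natr1 -{4}(prednK k0) !exprS.
  ring.
have [r ->] := iE p`!; exists ((p.-1)`!%:R * h + r).
have -> : p`! = (p * (p.-1)`!)%N by rewrite -{1}(prednK (prime_gt0 p_pr)) factS prednK ?prime_gt0.
rewrite natrM exprS; ring.
Qed.

(** A form of Gauss's lemma: F_p[[x]] is a domain, so factors p are extracted from [h] one by
    one. *)
Lemma ps_dvd_natp k g h r : psred g != 0 -> g * h = p%:R ^+ k * r ->
  exists h', h = p%:R ^+ k * h'.
Proof.
move=> rg; elim: k h r => [|k IHk] h r e; first by exists h; rewrite mul1r.
have [h1 hE] : exists h1, h = p%:R * h1.
  have /psred_congP[h1 ->] : psred h = psred (0 : pseries Zp).
    apply: (ps_mulI rg); rewrite -!rmorphM e /= mulr0.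
    by apply/psred_congP; exists (p%:R ^+ k * r); rewrite exprS; ring.
  by exists h1; rewrite add0r.
have [|h2 h1E] := IHk h1 r.
  apply: (ps_mulI (ps_natp_neq0 p_pr 1)); rewrite expr1 [RHS]mulrA -exprS -e hE.
  by rewrite mulrCA.
by exists h2; rewrite hE h1E mulrA exprS.
Qed.

(* Otherwise uiter (n + 2) = x modulo p^3, while it fixes the zeros of
   F (n + 2): its multiplier would be too close to 1. *)
Lemma uiter_neqX n : psred (uiter n) != psX.
Proof.
apply/eqP => uX; have unX : pscong (p%:R ^+ 1) (uiter n) psX.
  by rewrite expr1; apply/psred_congP; rewrite uX /psred psmapX.
have : pscong (p%:R ^+ 3) (uiter n.+2) psX.
  rewrite uiterS; apply: (@pscong_iter_p 2) => //; first exact: uiter0.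
  by rewrite uiterS; apply: (@pscong_iter_p 1) => //; exact: uiter0.
have [r uE] := uiter_fixed n.+2; rewrite uE => -[h] /addrI Fr.
have [r' rE] := ps_dvd_natp (psred_F_neq0 f0 fp _) Fr.
have [c [uc c0]] := uiter_coef1 n.+2.
have := congr1 (fun t : pseries Zp => t 1%N) uE.
rewrite uc psDE psM1 psiter_coef0 // mul0r add0r psiter_coef1 // f1.
have -> : r 0%N = p%:R ^+ 3 * r' 0%N by rewrite rE -natrX psnatME natrX.
move=> /addrI.
(* Comparison of valuations: the right-hand side has at least n + 2 + 3, the left exactly n + 2 + s,
   and s is at most 2. *)
have -> : (p%:R * a) ^+ n.+2 * (p%:R ^+ 3 * r' 0%N)
          = p%:R ^+ (n.+2 + s) * (p%:R * (p%:R ^+ (2 - s) * a ^+ n.+2 * r' 0%N)).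
  have -> : p%:R ^+ 3 = p%:R ^+ s * p%:R * p%:R ^+ (2 - s) :> Zp.
    by rewrite -exprSr -exprD; congr (_ ^+ _); lia.
  rewrite exprMn exprD; ring.
have pn0 : p%:R ^+ (n.+2 + s) != 0 :> Zp by rewrite expf_neq0 ?zp_natp_neq0.
move=> /(mulfI pn0) cE; case/eqP: c0; apply/residue_dvdP.
by exists (p%:R ^+ (2 - s) * a ^+ n.+2 * r' 0%N).
Qed.

Local Notation fb := (psred f).
Local Notation ub := (psred u).

(** F_n divides u_n - x and vanishes to order greater than n modulo p, while u_n - x is nonzero
    modulo p. *)
Lemma uiter_psred n : exists m (w : pseries 'F_p),
  [/\ (n < m)%N, w 0%N != 0 & psred (uiter n) = psX + psX ^+ m * w].
Proof.
have [r uE] := uiter_fixed n; have [h FE] := psred_F_order f0 n flt.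
have redE : psred (uiter n) - psX = psX ^+ n.+1 * (h * psred r).
  by rewrite uE rmorphD rmorphM /= FE {1}/psred psmapX addrAC subrr add0r mulrA.
have : psred (uiter n) - psX != 0 by rewrite subr_eq0 uiter_neqX.
move=> /ps_order[m [w [wE w0]]]; exists m, w; split=> //.
  rewrite ltnNge; apply: contra w0 => mn; apply/eqP.
  have := congr1 (fun t : pseries 'F_p => t m) redE.
  by rewrite wE !psXnE ltnn subnn ltnS mn.
by rewrite -wE addrC subrK.
Qed.

(* Compare the orders in t(x + eps) = t + t' eps + O(eps^2), eps = u_n - x. *)
Lemma deriv_eq0 (t : pseries 'F_p) :
  (forall n m w, (n < m)%N -> psred (uiter n) = psX + psX ^+ m * w ->
    exists q, pscomp t (psred (uiter n)) = t + psX ^+ (2 * m) * q) ->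
  psderiv t = 0.
Proof.
move=> tP; apply/eqP; apply: contrapT => /negP /ps_order[k [g [tE g0]]].
(* Taking for n the order k of t' ensures m > k, so that t' eps has order m + k, less than 2 m. *)
have [m [w [km w0 uE]]] := uiter_psred k.
have un0 : psred (uiter k) 0%N = 0 by rewrite psred_coef uiter0 rmorph0.
have [q qE] := tP k m w km uE.
have [h hE] := ps_taylor t (y := psX) (erefl _) un0.
move: hE; rewrite qE !pscompx -addrA => /addrI.
rewrite uE [_ - psX]addrAC subrr add0r tE => e.
have : g * w = psX * (psX ^+ (m - k).-1 * (q - w ^+ 2 * h)).
  apply: (ps_mulI (psXn_neq0 _ (m + k))).
  have e2 : psX ^+ (2 * m) = psX ^+ (m + k) * psX ^+ (m - k) :> pseries 'F_p.
    by rewrite -exprD; congr (_ ^+ _); lia.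
  have eX : psX * psX ^+ (m - k).-1 = psX ^+ (m - k) :> pseries 'F_p.
    by rewrite -exprS prednK // subn_gt0.
  rewrite [RHS](_ : _ = psX ^+ (2 * m) * (q - w ^+ 2 * h)); last first.
    by rewrite e2 -eX; ring.
  rewrite mulrBr e mulnC exprM exprD; ring.
move=> /(congr1 (fun t : pseries 'F_p => t 0%N)) /eqP.
by rewrite psM0 psX0 mulf_eq0 (negPf g0) (negPf w0).
Qed.

Lemma psred_u0 : ub 0%N = 0. Proof. by rewrite psred_coef u0 rmorph0. Qed.
Lemma psred_f0 : fb 0%N = 0. Proof. by rewrite psred_coef f0 rmorph0. Qed.

(** Modulo p, f(u_n) = u_n(f) = f + f^m w(f), and x^2 divides [f], so the error is a multiple of
    x^(2m), as [deriv_eq0] demands. *)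
Lemma psred_deriv_f : psderiv fb = 0.
Proof.
apply: deriv_eq0 => n m w nm uE.
have un0 : psred (uiter n) 0%N = 0 by rewrite psred_coef uiter0 rmorph0.
have -> : pscomp fb (psred (uiter n)) = pscomp (psred (uiter n)) fb.
  by rewrite /psred -!psmap_comp; congr psmap; exact: pscommute_iter.
have [g fE] : exists g : pseries 'F_p, fb = psX ^+ 2 * g.
  by have [g] := psred_F_order f0 1 flt; rewrite psiter1; exists g.
rewrite uE pscompD pscompM ?psred_f0 // pscompXn ?psred_f0 // pscompX ?psred_f0 //.
exists (g ^+ m * pscomp w fb); congr (_ + _).
by rewrite {1}fE exprMn -exprM mulrA.
Qed.

(** After subtracting t(0), the derivative vanishes by [deriv_eq0], so the series is the p-th power
    of another fixed series without constant term. Repeating this, it is a p^k-th power for every k,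
    hence 0. *)
Lemma fixed_const (t : pseries 'F_p) : pscomp t ub = t -> t = psC (t 0%N).
Proof.
move=> tu; apply/eqP; rewrite -subr_eq0; apply/eqP.
set t' := t - psC (t 0%N).
have t'0 : t' 0%N = 0 by rewrite /t' psBE subrr.
have t'u : pscomp t' ub = t' by rewrite pscompB tu pscompC ?psred_u0.
move: t' t'0 t'u => {tu}t t0 tu.
have root (r : pseries 'F_p) : r 0%N = 0 -> pscomp r ub = r ->
    exists q : pseries 'F_p, [/\ q 0%N = 0, pscomp q ub = q & r = q ^+ p].
  move=> r0 ru; have ruk k : pscomp r (psiter ub k) = r.
    elim: k => [|k IHk]; first exact: pscompx.
    by rewrite psiterS pscompA ?psiter_coef0 ?psred_u0 // ru.
  have /ps_deriv0 : psderiv r = 0.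
    apply: deriv_eq0 => n m w _ _; exists 0.
    by rewrite mulr0 addr0 /psred psmap_iter ruk.
  case/(_ p_pr) => q rE; exists q; split; last by rewrite ps_frobenius.
    by rewrite -r0 rE pscomp_coef0 // psXp0.
  have X0 := psXp0 p_pr.
  (* Over F_p, x^p commutes with [ub], so q(u) and q agree after the injective substitution of
     x^p. *)
  apply: (@ps_comp_inj _ _ _ _ X0); first exact: psXn_neq0.
  rewrite -rE -ru rE [RHS]pscompA' ?psred_u0 //.
have Xu : pscomp (psX ^+ p) ub = pscomp ub (psX ^+ p).
    by rewrite (pscompXn psX p psred_u0) (pscompX psred_u0) (ps_frobenius p_pr).
  by rewrite Xu (pscompA q psred_u0 X0).
have pow k : exists q : pseries 'F_p, [/\ q 0%N = 0, pscomp q ub = q & t = q ^+ (p ^ k)].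
  elim: k => [|k [q [q0 qu ->]]]; first by exists t.
  have [r [r0 ru ->]] := root q q0 qu; exists r; split=> //.
  by rewrite -exprM expnS.
apply/funext => n; have [q [q0 _ ->]] := pow n.
by rewrite exp_coef0 // ltn_expl // prime_gt1.
Qed.

End Nontorsion.

(** * Lifting commuting series to characteristic 0 *)

Lemma pscong_cancel (R : comNzRingType) (d c m f g : pseries R) :
  c * m = 1 -> pscong d (f * m) (g * m) -> pscong d f g.
Proof.
move=> cm fg; have cK h : h * m * c = h by rewrite -mulrA [m * c]mulrC cm mulr1.
by rewrite -(cK f) -(cK g); apply: pscongM => //; exact: pscong_refl.
Qed.

Section Lifting.
Variables (p : nat) (p_pr : prime p).
Local Notation Zp := (padic_int p_pr).
Implicit Types v w A B : pseries Zp.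

Variables (f u : pseries Zp) (a : Zp).
Hypotheses (f0 : f 0%N = 0) (f1 : f 1%N = p%:R * a) (a0 : residue a != 0).
Hypotheses (u0 : u 0%N = 0) (u1 : residue (u 1%N) != 0) (fu : pscommute f u).
Local Notation fb := (psred f).
Local Notation ub := (psred u).
Hypotheses (fb_neq0 : fb != 0) (dfb : psderiv fb = 0).
Hypothesis const_fix : forall t : pseries 'F_p, pscomp t ub = t -> t = psC (t 0%N).

Let fb0 : fb 0%N = 0. Proof. by rewrite psred_coef f0 rmorph0. Qed.

Let p_inj k : injective (fun g : pseries Zp => p%:R ^+ k * g).
Proof. by move=> g h; exact/ps_mulI/ps_natp_neq0. Qed.

Lemma psderiv_f_dvd : exists g : pseries Zp, psderiv f = p%:R * g /\ g 0%N = a.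
Proof.
have /psred_congP[g fg] : psred (psderiv f) = psred (0 : pseries Zp).
  by rewrite /psred psmap_deriv dfb; exact/esym/rmorph0.
exists g; rewrite add0r in fg; split=> //.
have /(congr1 (fun t : pseries Zp => t 0%N)) := fg.
rewrite psnatME /psderiv mulr1n f1 => e.
by apply: (mulfI (zp_natp_neq0 p_pr)).
Qed.

(** Because p divides f', the first-order Taylor term gains a factor p; the second-order one is
    divisible by p^(2k). *)
Lemma pscong_fcomp k A B : A 0%N = 0 -> B 0%N = 0 -> (0 < k)%N ->
  pscong (p%:R ^+ k) A B -> pscong (p%:R ^+ k.+1) (pscomp f A) (pscomp f B).
Proof.
move=> A0 B0 k0 [t AB]; have [g [fg _]] := psderiv_f_dvd.
have [h ->] := ps_taylor f B0 A0.
rewrite fg pscompM // pscomp_nat // AB [B + _]addrC addrK.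
exists (pscomp g B * t + p%:R ^+ k.-1 * t ^+ 2 * h).
rewrite [p%:R ^+ k.+1]exprS.
have -> : (p%:R ^+ k : pseries Zp) = p%:R * p%:R ^+ k.-1 by rewrite -exprS prednK.
ring.
Qed.

(** Write A = B + p^k t. As f(A) = f(B) modulo p^(k+1), commutation yields t(f) = 0 modulo p, whence
    t = 0 modulo p. *)
Lemma pscommute_unique k A B : A 0%N = 0 -> B 0%N = 0 -> (0 < k)%N ->
  pscong (p%:R ^+ k.+1) (pscomp f A) (pscomp A f) ->
  pscong (p%:R ^+ k.+1) (pscomp f B) (pscomp B f) ->
  pscong (p%:R ^+ k) A B -> pscong (p%:R ^+ k.+1) A B.
Proof.
move=> A0 B0 k0 Af Bf AB; have fAB := pscong_fcomp A0 B0 k0 AB.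
have [t AE] := AB.
have [s sE] : pscong (p%:R ^+ k.+1) (pscomp A f) (pscomp B f).
  exact: pscong_trans (pscong_sym Af) (pscong_trans fAB Bf).
have tf : pscomp t f = p%:R * s.
  apply: (@p_inj k); apply: (addrI (pscomp B f)).
  rewrite /= mulrA -exprSr -sE AE pscompD pscompM //.
  by rewrite -natrX pscomp_nat.
have /psred_congP[r rE] : psred t = psred (0 : pseries Zp).
  apply: (ps_comp_inj fb0 fb_neq0); rewrite /psred -!psmap_comp -!/(psred _).
  apply/psred_congP; rewrite tf; exists s.
  by rewrite -(subrr t) pscompB !subrr add0r.
by exists r; rewrite AE rE add0r exprSr mulrA.
Qed.

(** Successive approximation: if w = c + p^j t with j < k, then [t] is fixed by [u] modulo p, hence
    constant modulo p by [const_fix]. *)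
Lemma pscong_const k w : pscong (p%:R ^+ k) (pscomp w u) w ->
  pscong (p%:R ^+ k) w (psC (w 0%N)).
Proof.
move=> wu; suff [c [t wE]] : exists c, pscong (p%:R ^+ k) w (psC c).
  exists (t - psC (t 0%N)); have := congr1 (fun t : pseries Zp => t 0%N) wE.
  rewrite psDE -natrX psnatME natrX /= => ->.
  rewrite {1}wE rmorphD rmorphM rmorphXn rmorph_nat natrX /=; ring.
have : (k <= k)%N by [].
move: {1 3}k; elim=> [|j IHj] jk.
  by exists 0; exists (w - psC 0); rewrite expr0 mul1r addrC subrK.
have [c [t wE]] := IHj (ltnW jk).
have [s sE] := wu.
have tu : pscomp t u = t + p%:R * (p%:R ^+ (k - j.+1) * s).
  apply: (@p_inj j); apply: (addrI (psC c)); rewrite /= mulrDr addrA -wE.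
  rewrite [X in _ = w + X](_ : _ = p%:R ^+ k * s); last first.
    by rewrite !mulrA -exprSr -exprD subnKC.
  by rewrite -sE wE pscompD pscompM // pscompC // -natrX pscomp_nat.
have /psred_congP[r rE] : psred t = psred (psC (t 0%N)).
  rewrite [LHS]const_fix.
    by apply/funext => -[|n]; rewrite /psred /psmap //= rmorph0.
  rewrite /psred -psmap_comp; apply/psred_congP; rewrite tu.
  by exists (p%:R ^+ (k - j.+1) * s).
exists (c + p%:R ^+ j * t 0%N); exists r.
rewrite wE {1}rE rmorphD rmorphM rmorphXn rmorph_nat exprS /=; ring.
Qed.

Lemma ps_unit_comp (w y : pseries Zp) : y 0%N = 0 -> residue (w 0%N) != 0 ->
  exists c, c * pscomp w y = 1.
Proof. by move=> y0 w0; apply: ps_unit; rewrite pscomp_coef0. Qed.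

(* The ratio of the two sides is a series fixed by u modulo p^k, hence a
   constant modulo p^k, and its constant term is 1. *)
Lemma deriv_ratio k g w : psderiv f = p%:R * g -> g 0%N = a ->
  w 0%N = 0 -> residue (w 1%N) != 0 ->
  pscong (p%:R ^+ k) (pscomp f w) (pscomp w f) ->
  pscong (p%:R ^+ k) (pscomp u w) (pscomp w u) ->
  pscong (p%:R ^+ k) (pscomp g w * psderiv w) (pscomp (psderiv w) f * g).
Proof.
move=> fg g0 w0 w1 fw uw; set q := p%:R ^+ k.
have qcomp y A B : y 0%N = 0 -> pscong q A B -> pscong q (pscomp A y) (pscomp B y).
  by rewrite /q -natrX; exact: pscong_compl_nat.
have qderiv A B : pscong q A B -> pscong q (psderiv A) (psderiv B).
  by rewrite /q -natrX; exact: pscong_deriv_nat.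
have du0 : psderiv u 0%N = u 1%N by rewrite /psderiv mulr1n.
have dw0 : psderiv w 0%N = w 1%N by rewrite /psderiv mulr1n.
have fw0 : pscomp f w 0%N = 0 by rewrite pscomp_coef0.
have wf0 : pscomp w f 0%N = 0 by rewrite pscomp_coef0.
have uw0 : pscomp u w 0%N = 0 by rewrite pscomp_coef0.
have wu0 : pscomp w u 0%N = 0 by rewrite pscomp_coef0.
have fu0 : pscomp f u 0%N = 0 by rewrite pscomp_coef0.
have uf0 : pscomp u f 0%N = 0 by rewrite pscomp_coef0.
(* Differentiate f(u) = u(f) and cancel p. *)
have gu : pscomp g u * psderiv u = pscomp (psderiv u) f * g.
  apply: (@p_inj 1); rewrite /= expr1; have := congr1 (@psderiv _) fu.
  rewrite !psderiv_comp // fg pscompM // pscomp_nat // => e.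
  by rewrite mulrA e; ring.
have gw : pscomp g (pscomp u w) * pscomp (psderiv u) w
          = pscomp (psderiv u) (pscomp f w) * pscomp g w.
  have := congr1 (fun t => pscomp t w) gu.
  by rewrite !(pscompM _ _ w0) (pscompA' _ u0 w0) (pscompA' _ f0 w0).
have dw : pscong q (pscomp (psderiv w) u * psderiv u)
                   (pscomp (psderiv u) w * psderiv w).
  by rewrite -!psderiv_comp //; apply/qderiv/pscong_sym.
have dwf : pscong q (pscomp (psderiv w) (pscomp f u) * pscomp (psderiv u) f)
                    (pscomp (psderiv u) (pscomp w f) * pscomp (psderiv w) f).
  rewrite [pscomp f u]fu; have := qcomp f _ _ f0 dw.
  by rewrite !(pscompM _ _ f0) (pscompA' _ u0 f0) (pscompA' _ w0 f0).
set num := pscomp g w * psderiv w; set den := pscomp (psderiv w) f * g.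
have [di diE] : exists di, di * den = 1.
  by apply: ps_unit; rewrite /den psM0 pscomp_coef0 // dw0 g0 rmorphM mulf_neq0.
have du0' : residue (psderiv u 0%N) != 0 by rewrite du0.
have [c1 c1E] : exists c, c * psderiv u = 1 by apply: ps_unit; rewrite du0.
have [c2 c2E] := ps_unit_comp f0 du0'.
have [c3 c3E] := ps_unit_comp w0 du0'.
pose M := psderiv u * pscomp (psderiv u) f * pscomp (psderiv u) w.
have ME : c1 * c2 * c3 * M = 1.
  rewrite /M; transitivity ((c1 * psderiv u) * (c2 * pscomp (psderiv u) f)
    * (c3 * pscomp (psderiv u) w)); first by ring.
  by rewrite c1E c2E c3E !mulr1.
have numu : pscomp num u = pscomp g (pscomp w u) * pscomp (psderiv w) u.
  by rewrite /num (pscompM _ _ u0) (pscompA' _ w0 u0).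
have denu : pscomp den u = pscomp (psderiv w) (pscomp f u) * pscomp g u.
  by rewrite /den (pscompM _ _ u0) (pscompA' _ f0 u0).
(* Cross-multiplied form of the invariance of num / den under [u]; multiplying by the unit [M] lets
   the chain rules [gu], [gw], [dw] and [dwf] apply. *)
have swap : pscong q (pscomp num u * den) (num * pscomp den u).
  apply: (pscong_cancel ME).
  apply: (@pscong_trans _ _ _ (pscomp (psderiv u) (pscomp f w) * pscomp g w
     * (pscomp (psderiv u) w * psderiv w) * (den * pscomp (psderiv u) f))).
    rewrite numu /M -gw.
    have -> : pscomp g (pscomp w u) * pscomp (psderiv w) u * den *
      (psderiv u * pscomp (psderiv u) f * pscomp (psderiv u) w) =
      (pscomp g (pscomp w u) * pscomp (psderiv u) w)
      * (pscomp (psderiv w) u * psderiv u) * (den * pscomp (psderiv u) f) by ring.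
    apply: pscongM; last exact: pscong_refl.
    apply: pscongM dw; apply: pscongM; last exact: pscong_refl.
    by apply: pscong_comp => //; exact: pscong_sym.
  have -> : num * pscomp den u * M = pscomp g w * (pscomp (psderiv u) w * psderiv w)
     * g * pscomp (psderiv u) f
     * (pscomp (psderiv w) (pscomp f u) * pscomp (psderiv u) f).
    transitivity (pscomp g w * (pscomp (psderiv u) w * psderiv w)
      * (pscomp (psderiv u) f * g)
      * (pscomp (psderiv w) (pscomp f u) * pscomp (psderiv u) f)); last by ring.
    by rewrite -gu denu /num /M; ring.
  have -> : pscomp (psderiv u) (pscomp f w) * pscomp g w *
     (pscomp (psderiv u) w * psderiv w) * (den * pscomp (psderiv u) f) =
     pscomp g w * (pscomp (psderiv u) w * psderiv w) * g * pscomp (psderiv u) f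
     * (pscomp (psderiv u) (pscomp f w) * pscomp (psderiv w) f).
    by rewrite /den; ring.
  apply: pscongM; first exact: pscong_refl.
  apply: pscong_sym; apply: pscong_trans dwf _.
  apply: pscongM; last exact: pscong_refl.
  by apply: pscong_comp => //; exact: pscong_sym.
have diu : pscomp di u * pscomp den u = 1 by rewrite -pscompM // diE pscomp1.
(* The ratio is congruent to its constant term, a w'(0) / (w'(0) a) = 1. *)
have rho : pscong q (num * di) 1.
  have : pscong q (num * di) (psC ((num * di) 0%N)).
    apply: pscong_const; apply: (pscong_cancel (m := den * pscomp den u) (c := di * pscomp di u)).
      by rewrite mulrACA diE diu mulr1.
    rewrite pscompM //.
    have -> : pscomp num u * pscomp di u * (den * pscomp den u)
       = pscomp num u * den * (pscomp di u * pscomp den u) by ring.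
    have -> : num * di * (den * pscomp den u) = num * pscomp den u * (di * den) by ring.
    by rewrite diE diu !mulr1.
  have di0 : di 0%N * (w 1%N * a) = 1.
    have := congr1 (fun t : pseries Zp => t 0%N) diE.
    by rewrite psM0 /den psM0 pscomp_coef0 // dw0 g0.
  rewrite psM0 /num psM0 pscomp_coef0 // dw0 g0.
  by have -> : a * w 1%N * di 0%N = 1 by rewrite -di0; ring.
rewrite -[den]mul1r; apply: pscong_trans (pscongM rho (pscong_refl _ den)).
by rewrite -mulrA diE mulr1; exact: pscong_refl.
Qed.

Lemma psred_lift (t : pseries 'F_p) : t 0%N = 0 ->
  exists w, w 0%N = 0 /\ psred w = t.
Proof.
move=> t0; have [w wE] := psred_surj p_pr (psshift t).
exists (psX * w); split; first exact: psX0.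
by rewrite rmorphM /= wE {1}/psred psmapX -psX_dvd.
Qed.

Variables h h' : pseries 'F_p.
Hypotheses (h0 : h 0%N = 0) (h'0 : h' 0%N = 0).
Hypotheses (fbE : fb = pscomp h (psX ^+ p)) (h'h : pscomp h' h = psX).

Definition commutes_mod k w := [/\ w 0%N = 0, residue (w 1%N) != 0,
  pscong (p%:R ^+ k) (pscomp f w) (pscomp w f)
  & pscong (p%:R ^+ k) (pscomp u w) (pscomp w u)].

(** If f(w) = w(f) + p^k e, the correction w + p^k v requires v(f) = e modulo p. By [deriv_ratio],
    e' = 0 modulo p, so e = T(x^p), and v = T o h' works because f = h(x^p) modulo p. *)
Lemma lift_step k w : (0 < k)%N -> commutes_mod k w ->
  exists w', commutes_mod k.+1 w' /\ pscong (p%:R ^+ k) w' w.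
Proof.
move=> k0 [w0 w1 fw uw]; have [g [fg g0]] := psderiv_f_dvd.
have [s sE] := deriv_ratio fg g0 w0 w1 fw uw.
have [e eE] := fw; have X0 := psXp0 p_pr.
have [T reE] : exists T : pseries 'F_p, psred e = pscomp T (psX ^+ p).
  apply: ps_deriv0 => //; rewrite /psred -psmap_deriv -/(psred _).
  have -> : psderiv e = p%:R * s.
    apply: (@p_inj k); rewrite /= mulrCA; apply: (addrI (psderiv (pscomp w f))).
    rewrite [in LHS]psderiv_comp // fg.
    have := congr1 (@psderiv _) eE.
    rewrite psderivD -natrX psderiv_natM natrX !psderiv_comp // fg => <-.
    rewrite pscompM // pscomp_nat // -mulrA sE; ring.
  apply/eqP; rewrite -[0](rmorph0 (@psred p p_pr)); apply/eqP/psred_congP.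
  by exists s; rewrite add0r.
have e0 : e 0%N = 0.
  have := congr1 (fun t : pseries Zp => t 0%N) eE.
  rewrite psDE -natrX psnatME natrX !pscomp_coef0 // f0 w0 add0r => /esym/eqP.
  by rewrite mulf_eq0 expf_eq0 (negPf (zp_natp_neq0 p_pr)) andbF => /eqP.
have T0 : T 0%N = 0 by rewrite -(pscomp_coef0 T X0) -reE psred_coef e0 rmorph0.
have [v [v0 vE]] : exists v, v 0%N = 0 /\ psred v = pscomp T h'.
  by apply: psred_lift; rewrite pscomp_coef0.
have [r rE] : pscong p%:R e (pscomp v f).
  apply/psred_congP; rewrite {2}/psred psmap_comp -!/(psred _) vE fbE.
  by rewrite reE (pscompA _ h0 X0) (pscompA' T h'0 h0) h'h pscompx.
pose w' := w + p%:R ^+ k * v.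
have w'0 : w' 0%N = 0 by rewrite /w' psDE -natrX psnatME w0 v0 mulr0 addr0.
have w'w : pscong (p%:R ^+ k) w' w by exists v.
have fw' : pscong (p%:R ^+ k.+1) (pscomp f w') (pscomp w' f).
  apply: pscong_trans (pscong_fcomp w'0 w0 k0 w'w) _.
  exists r; rewrite eE rE /w' pscompD pscompM // -natrX pscomp_nat // natrX exprSr.
  ring.
exists w'; split=> //; split=> //.
  have [c ->] : exists c, w' 1%N = w 1%N + p%:R ^+ k * c.
    by exists (v 1%N); rewrite /w' psDE -natrX psnatME natrX.
  rewrite rmorphD rmorphM rmorphXn rmorph_nat /= pchar_Fp_0 // expr0n.
  by rewrite (gtn_eqF k0) mul0r addr0.
have uw'0 : pscomp u w' 0%N = 0 by rewrite pscomp_coef0.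
have w'u0 : pscomp w' u 0%N = 0 by rewrite pscomp_coef0.
(* u(w') and w'(u) both commute with [f] modulo p^(k+1) and agree modulo p^k. *)
apply: (pscommute_unique uw'0 w'u0 k0).
- rewrite (pscompA f u0 w'0) fu (pscompA' u f0 w'0) (pscompA' u w'0 f0).
  by apply: (pscong_comp _ _ _ fw'); rewrite pscomp_coef0.
- rewrite (pscompA f w'0 u0) (pscompA' w' u0 f0) -fu (pscompA w' f0 u0) -natrX.
  by apply: pscong_compl_nat => //; rewrite natrX.
apply: pscong_trans (pscong_comp u w'0 w0 w'w) _.
apply: pscong_trans uw _; rewrite -natrX; apply: pscong_compl_nat => //.
by rewrite natrX; exact: pscong_sym.
Qed.

(** Iterating [lift_step] gives a p-adically convergent sequence, whose limit commutes with [f] and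
    [u] modulo every power of p. *)
Lemma commuting_lift (t : pseries 'F_p) : t 0%N = 0 -> t 1%N != 0 ->
  pscommute fb t -> pscommute ub t ->
  exists w, [/\ w 0%N = 0, psred w = t, pscommute f w & pscommute u w].
Proof.
move=> t0 t1 ft ut; have [w [w0 wt]] := psred_lift t0.
have P1w : commutes_mod 1 w.
  split=> //; first by rewrite -psred_coef wt.
    by rewrite expr1; apply/psred_congP; rewrite /psred !psmap_comp -!/(psred _) wt.
  by rewrite expr1; apply/psred_congP; rewrite /psred !psmap_comp -!/(psred _) wt.
(* Each term carries its proof, from which the next one is chosen; term k commutes modulo
   p^(k+1). *)
pose S k := {w | commutes_mod k.+1 w}.
have step k (x : S k) : {y : S k.+1 | pscong (p%:R ^+ k.+1) (sval y) (sval x)}.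
  apply: cid; case: x => x Px; have [y [Py yx]] := lift_step (ltn0Sn k) Px.
  by exists (exist _ y Py).
pose fix seq k : S k :=
  if k is j.+1 then sval (step j (seq j)) else exist _ w P1w.
have seqS k : pscong (p%:R ^+ k.+1) (sval (seq k.+1)) (sval (seq k)).
  exact: svalP (step k (seq k)).
have [|W WP] := pscong_complete (s := fun k => sval (seq k)).
  move=> k; apply: (@pscong_dvd _ _ p%:R); rewrite -exprSr; exact: seqS.
have W0 : W 0%N = 0.
  suff e : psC (W 0%N) = 0 by exact: (congr1 (fun t : pseries Zp => t 0%N) e).
  apply: (@pscong_separated _ p_pr) => k; have [x WE] := WP k; exists (psC (x 0%N)).
  have := congr1 (fun t : pseries Zp => t 0%N) WE.
  rewrite psDE -natrX psnatME; case: (svalP (seq k)) => -> _ _ _ ->.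
  by rewrite !add0r rmorphM rmorph_nat.
have comm g : g 0%N = 0 ->
    (forall k, pscong (p%:R ^+ k.+1) (pscomp g (sval (seq k))) (pscomp (sval (seq k)) g)) ->
    pscommute g W.
  move=> g0 gP; apply: pscong_separated => k.
  have sk0 : sval (seq k) 0%N = 0 by case: (svalP (seq k)).
  apply: (@pscong_trans _ _ _ (pscomp g (sval (seq k)))); first exact: pscong_comp.
  apply: (@pscong_trans _ _ _ (pscomp (sval (seq k)) g)).
    by apply: (@pscong_dvd _ _ p%:R); rewrite -exprSr.
  by rewrite -natrX; apply: pscong_compl_nat; rewrite ?natrX //; apply: pscong_sym.
exists W; split=> //.
- rewrite -wt; apply/psred_congP; have := WP 1%N; rewrite expr1 => /pscong_trans; apply.
  by have := seqS 0%N; rewrite expr1.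
- by apply: comm => // k; case: (svalP (seq k)).
- by apply: comm => // k; case: (svalP (seq k)).
Qed.

End Lifting.

(** * Lubin-Tate series *)

Lemma pscomp_coef_extr (R : comNzRingType) (f y z : pseries R) n :
  y 0%N = 0 -> z 0%N = 0 -> (forall i, (i <= n)%N -> y i = z i) ->
  pscomp f y n = pscomp f z n.
Proof.
move=> y0 z0 yz; apply/eqP; rewrite -subr_eq0 -psBE psdiffE //.
rewrite psME big1 // => i _; rewrite psBE yz ?subrr ?mul0r //.
by rewrite -ltnS.
Qed.

Section LubinTate.
Variables (p : nat) (p_pr : prime p).
Local Notation Zp := (padic_int p_pr).
Implicit Types z A B : pseries Zp.

Variables (f : pseries Zp) (a : Zp).
Hypotheses (f0 : f 0%N = 0) (f1 : f 1%N = p%:R * a) (a0 : residue a != 0).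

Lemma exp_pn1_unit n : residue ((p%:R * a) ^+ n.+1 - 1) != 0.
Proof.
rewrite rmorphB rmorph1 rmorphXn rmorphM rmorph_nat /= pchar_Fp_0 //.
by rewrite mul0r expr0n sub0r oppr_eq0 oner_eq0.
Qed.

(** If A - B = x^N d with d(0) nonzero and N at least 2, leading coefficients give f'(0) d(0) =
    f'(0)^N d(0); but f'(0) is nonzero and f'(0)^(N-1) - 1 is a unit. *)
Lemma commutant_unique A B : A 0%N = 0 -> B 0%N = 0 -> A 1%N = B 1%N ->
  pscommute f A -> pscommute f B -> A = B.
Proof.
move=> A0 B0 AB1 fA fB; apply/eqP; rewrite -subr_eq0; apply: contrapT => /negP.
move=> /ps_order[[|[|m]] [d [DE d0]]].
- have := congr1 (fun t : pseries Zp => t 0%N) DE.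
  by rewrite psXnE psBE A0 B0 subrr /= => e; rewrite -e eqxx in d0.
- have := congr1 (fun t : pseries Zp => t 1%N) DE.
  by rewrite psXnE psBE AB1 subrr /= => e; rewrite -e eqxx in d0.
have := psdiffE f B0 A0; rewrite [pscomp f A]fA [pscomp f B]fB -pscompB DE.
rewrite (pscompM _ _ f0) (pscompXn psX _ f0) (pscompX f0) {1}(psX_dvd f0).
rewrite (exprMn m.+2 psX (psshift f)) -[LHS]mulrA -[RHS]mulrA.
move=> /(ps_mulI (psXn_neq0 _ _)) /(congr1 (fun t : pseries Zp => t 0%N)).
rewrite !psM0 pscomp_coef0 // /psdiff pseval_coef0 // psdivdiff_coef0 //=.
have -> : (psshift f ^+ m.+2) 0%N = (p%:R * a) ^+ m.+2.
  elim: (m.+2) => [|k IHk]; first by rewrite !expr0.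
  by rewrite !exprS psM0 IHk /psshift f1.
rewrite f1 => /eqP; rewrite -subr_eq0 exprS.
have -> : p%:R * a * (p%:R * a) ^+ m.+1 * d 0%N - d 0%N * (p%:R * a)
  = p%:R * a * (((p%:R * a) ^+ m.+1 - 1) * d 0%N) by ring.
have nz (b : Zp) : residue b != 0 -> b != 0 by apply: contra_neq => ->; exact: rmorph0.
rewrite !mulf_eq0 (negPf (zp_natp_neq0 p_pr)) (negPf (nz _ a0)) (negPf d0).
by rewrite (negPf (nz _ (exp_pn1_unit m))).
Qed.

Hypothesis fred : psred f = psX ^+ p.

(** Modulo p, x^p commutes with every series, so the defect in degree N is divisible by p; the
    coefficient to be chosen enters with factor f'(0) - f'(0)^N, which is p times a unit. *)
Lemma commutant_exists (c : Zp) :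
  exists z, [/\ z 0%N = 0, z 1%N = c & pscommute f z].
Proof.
pose P z n := [/\ z 0%N = 0, (0 < n)%N -> z 1%N = c
  & pscomp f z n = pscomp z f n].
have [z zP] : exists z, forall n, P z n.
  apply: ps_triangular => [y z n yz [y0 y1 yn]|z n zP].
    have z0 : z 0%N = 0 by rewrite -yz.
    split=> [//|n0|]; first by rewrite -yz // y1.
    rewrite -(pscomp_coef_extr f y0 z0 yz) yn; exact: pscomp_coef_ext.
  case: n zP => [|[|n]] zP.
  - exists 0; split=> //; rewrite !pscomp_coef0 //.
  - have [z0 _ _] := zP 0%N isT; exists c; split=> //=.
    by rewrite !pscomp_coef1 //= mulrC.
  have [z0 z1 _] := zP 1%N isT; have {}z1 := z1 isT.
  pose zn : pseries Zp := fun i => if (i < n.+2)%N then z i else 0.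
  have zn0 : zn 0%N = 0 by rewrite /zn.
  have [e eE] : exists e, pscomp f zn n.+2 - pscomp zn f n.+2 = p%:R * e.
    have zr0 : psred zn 0%N = 0 by rewrite psred_coef zn0 rmorph0.
    apply/residue_dvdP; rewrite -psBE -psred_coef rmorphB /=.
    rewrite /psred !psmap_comp -!/(psred _) fred (pscompXn psX p zr0) (pscompX zr0).
    by rewrite (ps_frobenius p_pr (psred zn)) subrr.
  have [b bE] : exists b, b * (a * ((p%:R * a) ^+ n.+1 - 1)) = 1.
    by apply: residue_unit; rewrite rmorphM mulf_neq0 // exp_pn1_unit.
  (* Since [b] inverts a ((p a)^(n+1) - 1), this choice cancels the defect p e. *)
  exists (b * e); set y := fun i => _.
  have yE : y = zn + psX ^+ n.+2 * psC (b * e) + psX ^+ n.+3 * (fun i => z (i + n.+3)%N).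
    apply/funext => i; rewrite /y /zn !psDE !psXnE.
    case: ltngtP => [lt|gt|->]; last by rewrite subnn /= ltnSn add0r addr0.
      by rewrite ltnS ltnW // !addr0.
    rewrite ltnS leqNgt gt /= subnK // add0r.
    by have := gt; rewrite -subn_gt0; case: (i - n.+2)%N => // k _; rewrite add0r.
  have y0 : y 0%N = 0 by [].
  split=> //; have yzn : pscomp f y n.+2 = pscomp f zn n.+2 + (p%:R * a) * (b * e).
    have w0 : (zn + psX ^+ n.+2 * psC (b * e)) 0%N = 0.
      by rewrite psDE psXnE addr0.
    rewrite (pscomp_coef_extr f y0 w0); last first.
      by move=> i il; rewrite yE !psDE (psXnE n.+3) ltnS il addr0.
    have [h ->] := ps_taylor f zn0 w0; rewrite [_ + _ - zn]addrAC subrr add0r.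
    rewrite !psDE mulrCA psXnE ltnn subnn psM0 pscomp_coef0 // {1}/psderiv mulr1n f1.
    have sqE : (psX ^+ n.+2 * psC (b * e)) ^+ 2 * h
        = psX ^+ (n.+2 * 2) * (psC (b * e) ^+ 2 * h).
      by rewrite exprM; ring.
    rewrite sqE psXnE ifT ?addr0 //; lia.
  rewrite yzn (pscomp_coefS y _ f0).
  have -> : pscomp (fun i => if (i < n.+2)%N then y i else 0) f n.+2 = pscomp zn f n.+2.
    congr (pscomp _ _ _); apply/funext => i; rewrite /zn /y.
    by case: ltngtP.
  have -> : y n.+2 = b * e by rewrite /y eqxx.
  have -> : pscomp f zn n.+2 = pscomp zn f n.+2 + p%:R * (b * (a * ((p%:R * a) ^+ n.+1 - 1))) * e.
    by rewrite bE mulr1 -eE addrC subrK.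
  rewrite f1 [_ ^+ n.+2]exprS; ring.
exists z; have [z0 _ _] := zP 0%N; have [_ z1 _] := zP 1%N.
by split=> //; [exact: z1|apply/funext => n; have [] := zP n].
Qed.

End LubinTate.

(** * Roots of unity in Z_p *)

Section RootsOfUnity.
Variables (p : nat) (p_pr : prime p).
Local Notation Zp := (padic_int p_pr).

Lemma exp_congr (R : comNzRingType) (y d : R) n :
  exists e, (y + d) ^+ n.+1 = y ^+ n.+1 + n.+1%:R * y ^+ n * d + d ^+ 2 * e.
Proof.
elim: n => [|n [e IHn]]; first by exists 0; rewrite !expr1 expr0; ring.
exists (e * (y + d) + n.+1%:R * y ^+ n); rewrite exprSr IHn.
rewrite -[n.+2%:R]natr1 [y ^+ n.+2]exprSr [y ^+ n.+1]exprSr; ring.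
Qed.

(** The limit of a^(p^k) for a lift [a] of [c]: p-th powers sharpen a congruence by one power of p.
    The limit equals its own p-th power and is nonzero. *)
Lemma teichmuller (c : 'F_p) : c != 0 ->
  exists z : Zp, z ^+ p.-1 = 1 /\ residue z = c.
Proof.
move=> c0; have [a ac] := residue_surj p_pr c.
have pE : p = p.-1.+1 by rewrite prednK // prime_gt0.
have step k (x y t : Zp) : x = y + p%:R ^+ k.+1 * t ->
    exists t', x ^+ p = y ^+ p + p%:R ^+ k.+2 * t'.
  move=> ->; have [e] := exp_congr y (p%:R ^+ k.+1 * t) p.-1; rewrite -pE => ->.
  by exists (y ^+ p.-1 * t + p%:R ^+ k * t ^+ 2 * e); rewrite !exprS; ring.
pose s k := a ^+ (p ^ k).
have sS k : s k.+1 = s k ^+ p by rewrite /s expnSr exprM.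
have sP k : exists t, s k.+1 = s k + p%:R ^+ k.+1 * t.
  elim: k => [|k [t IHk]]; last by rewrite (sS k.+1) {2}sS; apply: step IHk.
  have /residue_dvdP[t tE] : residue (a ^+ p - a) = 0.
    by rewrite rmorphB rmorphXn /= ac -[X in _ ^+ X](card_Fp p_pr) expf_card subrr.
  by exists t; rewrite /s expn1 expr1 expn0 expr1 -tE addrC subrK.
have [z zP] : exists z, forall k, exists t, z = s k + p%:R ^+ k * t.
  apply: zp_complete => k; have [t ->] := sP k; exists (p%:R * t).
  by rewrite exprSr mulrA.
have zc : residue z = c.
  have [t ->] := zP 1%N; rewrite rmorphD rmorphM rmorphXn rmorph_nat /= pchar_Fp_0 //.
  rewrite expr1 mul0r addr0 /s expn1 rmorphXn /= ac.
  by rewrite -[X in _ ^+ X](card_Fp p_pr) expf_card.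
have zp : z ^+ p = z.
  apply/eqP; rewrite -subr_eq0; apply/eqP; apply: zp_separated => k.
  have [t zt] := zP k.+1; have [t' zt'] := zP k.+2; have [r rE] := step _ _ _ _ zt.
  exists (p%:R ^+ 2 * (r - t')).
  rewrite rE zt' -sS !exprS; ring.
exists z; split=> //.
have z0 : z != 0 by apply: contra_neq c0 => z0; rewrite -zc z0; exact: rmorph0.
by apply: (mulfI z0); rewrite mulr1 -exprS -pE.
Qed.

(** For p = 2 take -1; for odd p, the Teichmueller lift of a generator of the multiplicative group
    of F_p, whose order is seen after reduction. *)
Lemma root_of_unity : exists z : Zp,
  [/\ residue z != 0, z ^+ e_of p = 1 & forall j, (1 <= j < e_of p)%N -> z ^+ j != 1].
Proof.
rewrite /e_of; case: ltnP => [p2|]; last first.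
  move=> p2; have {}p2 : p = 2 by apply/eqP; rewrite eqn_leq p2 prime_gt1.
  exists (-1); split=> [||[|[|j]] //]; last 2 first.
  - by rewrite sqrrN expr1n.
  - move=> _; rewrite expr1; apply/eqP => e; have /eqP := zp_natp_neq0 p_pr; case.
    have -> : (p%:R : Zp) = 1 + 1 by rewrite -[1 + 1]/(2%:R); congr (_%:R).
    by rewrite -{1}e addNr.
  by rewrite rmorphN rmorph1 oppr_eq0 oner_eq0.
have [c] : exists c : 'F_p, p.-1.-primitive_root c.
  have p1 : (0 < p.-1)%N by case: (p) p2 => [|[|]].
  pose rs := [seq x <- enum 'F_p | x != 0].
  have : has p.-1.-primitive_root rs.
    apply: has_prim_root => //.
    - apply/allP => x; rewrite mem_filter => /andP[x0 _]; apply/unity_rootP.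
      apply: (mulfI x0); rewrite mulr1 -exprS prednK ?prime_gt0 //.
      by rewrite -[X in _ ^+ X](card_Fp p_pr) expf_card.
    - by rewrite filter_uniq // enum_uniq.
    - rewrite size_filter -[X in (X.-1 <= _)%N](card_Fp p_pr) cardE.
      rewrite -(count_predC (fun x => x != 0)) addnC.
      have -> : count (predC (fun x : 'F_p => x != 0)) (enum 'F_p) = 1%N.
        rewrite (eq_count (a2 := pred1 0)) => [|x /=]; last by rewrite negbK.
        by rewrite count_uniq_mem ?enum_uniq // mem_enum.
      by [].
  by case/hasP => c _ cP; exists c.
move=> cP; have c0 : c != 0.
  apply/eqP => c0; have := prim_expr_order cP; rewrite c0 expr0n.
  by case: (p) p2 => [|[|[|k]]] //= _ /eqP; rewrite eq_sym oner_eq0.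
have [z [z1 zc]] := teichmuller c0; exists z; split=> [//||j /andP[j0 jp]].
  by rewrite zc.
  by [].
apply/eqP => zj; have : c ^+ j = 1 by rewrite -zc -rmorphXn /= zj rmorph1.
move/eqP; rewrite -(prim_order_dvd cP) => /dvdn_leq.
by move=> /(_ j0); rewrite leqNgt jp.
Qed.

End RootsOfUnity.

(** * Construction of the torsion series commuting with f and u *)

Theorem mainTheorem1 (p : nat) (p_pr : prime p)
  (Omega : closedFieldType) (iota : {rmorphism padic_field p_pr -> Omega})
  (Omega_closure : is_algebraic_closure iota)
  (f u : pseries (padic_int p_pr)) :
  minimal_commuting_pair f u ->
  (forall x : Omega, Lambda iota f x -> galois_adjoin iota x) ->
  exists z : pseries (padic_int p_pr),
    [/\ S0 z, pstorsion_order z (e_of p), pscommute z f & pscommute z u].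
Proof.
move=> [[[f0 _] [u0 _] fu] [_ _ _] /least_index_Some[fp flt] /vp_Some[a [f1 a0]]].
move=> /vp_Some[b [u1 b0]] _.
set s := delta_of p in u1.
have s_gt0 : (0 < s)%N by rewrite /s /delta_of; case: ifP.
have s_gt1 : p = 2 -> (1 < s)%N by rewrite /s /delta_of => ->.
have s_le2 : (s <= 2)%N by rewrite /s /delta_of; case: ifP.
have {}u1 : u 1%N = 1 + p%:R ^+ s * b by rewrite -u1 addrC subrK.
have {}flt i : (i < p)%N -> residue (f i) = 0.
  by move=> /flt; rewrite negbK => /eqP.
rewrite expr1 in f1.
have dfb := psred_deriv_f f0 f1 a0 fp flt u0 u1 b0 s_gt0 s_gt1 s_le2 fu.
have fixc := fixed_const f0 f1 a0 fp flt u0 u1 b0 s_gt0 s_gt1 s_le2 fu.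
have fb_n0 := psred_f_neq0 fp.
have X0 := psXp0 p_pr.
have [h fbE] := ps_deriv0 p_pr dfb.
have fb0 : psred f 0%N = 0 by rewrite psred_coef f0 rmorph0.
have ub0 : psred u 0%N = 0 by rewrite psred_coef u0 rmorph0.
have h0 : h 0%N = 0 by rewrite -(pscomp_coef0 h X0) -fbE.
have h1 : h 1%N != 0.
  (* Otherwise x^(2p) would divide [f] modulo p, whereas its coefficient of x^p is a unit. *)
  apply: contra_neq fp => h1; rewrite -psred_coef fbE.
  have -> : h = psX ^+ 2 * psshift (psshift h).
    rewrite {1}(psX_dvd h0) {1}[psshift h]psshiftE {1}/psshift h1 rmorph0 add0r.
    by rewrite exprS expr1 mulrA.
  rewrite (pscompM _ _ X0) (pscompXn psX _ X0) (pscompX X0) -exprM psXnE ifT //.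
  by rewrite -{1}[p]muln1 ltn_pmul2l // prime_gt0.
have Xcomm t : t 0%N = 0 -> pscomp (psX ^+ p) t = pscomp t (psX ^+ p) :> pseries 'F_p.
  by move=> t0; rewrite (pscompXn psX p t0) (pscompX t0) (ps_frobenius p_pr).
have hu : pscommute (psred u) h.
  (* Both sides are compared after the injective substitution of x^p, which commutes with [u] modulo
     p. *)
  apply: (ps_comp_inj X0 (psXn_neq0 _ p)); rewrite (pscompA' _ h0 X0) -fbE.
  rewrite (pscompA' _ ub0 X0) -(Xcomm _ ub0) (pscompA _ X0 ub0) -fbE.
  by rewrite /psred -!psmap_comp fu.
have hf : pscommute (psred f) h.
  by rewrite /pscommute fbE (pscompA' _ X0 h0) (Xcomm _ h0) (pscompA _ h0 X0).
have [h' [h'0 _ h'h _]] := ps_compinv h0 (mulVf h1).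
have u1r : residue (u 1%N) != 0.
  rewrite u1 rmorphD rmorph1 rmorphM rmorphXn rmorph_nat /= pchar_Fp_0 //.
  by rewrite expr0n (gtn_eqF s_gt0) mul0r addr0 oner_eq0.
have [W [W0 Wh fW uW]] :=
  commuting_lift f0 f1 a0 u0 u1r fu fb_n0 dfb fixc h0 h'0 fbE h'h h0 h1 hf hu.
have W1 : residue (W 1%N) != 0 by rewrite -psred_coef Wh.
have [c cW] := residue_unit W1.
have [V [V0 V1 VW WV]] := ps_compinv W0 cW.
have c0 : residue c != 0.
  apply/eqP => c0; have /eqP := congr1 (@residue p p_pr) cW.
  by rewrite rmorphM /= c0 mul0r rmorph1 eq_sym oner_eq0.
(* This is W^-1 o f, a Lubin-Tate series: x^p modulo p, with multiplier p times a unit. *)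
pose g := pscomp V f.
have g0 : g 0%N = 0 by rewrite /g pscomp_coef0.
have fE : f = pscomp W g by rewrite /g (pscompA W V0 f0) WV pscompX.
have g1 : g 1%N = p%:R * (c * a) by rewrite /g pscomp_coef1 // V1 f1 mulrCA.
have ca0 : residue (c * a) != 0 by rewrite rmorphM mulf_neq0.
have gred : psred g = psX ^+ p.
  have Vb0 : psred V 0%N = 0 by rewrite psred_coef V0 rmorph0.
  rewrite /g /psred psmap_comp -!/(psred _) fbE (pscompA _ h0 X0) -Wh.
  by rewrite /psred -psmap_comp VW psmapX pscompX.
have Winj A B : A 0%N = 0 -> B 0%N = 0 -> pscomp W A = pscomp W B -> A = B.
  move=> A0 B0 WAB; rewrite -(pscompX A0) -(pscompX B0) -VW.
  by rewrite !(pscompA' V W0) // WAB.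
have gW : pscommute g W.
  apply: Winj; rewrite ?pscomp_coef0 //.
  by rewrite (pscompA W g0 W0) (pscompA W W0 g0) -fE fW (pscompA' W W0 g0) -fE.
have gu : pscommute g u.
  apply: Winj; rewrite ?pscomp_coef0 //.
  by rewrite (pscompA W g0 u0) -fE fu (pscompA W u0 g0) -uW (pscompA' u W0 g0) -fE.
have [z1 [z1n0 z1e z1j]] := root_of_unity p_pr.
have [z [z0 zz1 gz]] := commutant_exists g0 g1 ca0 gred z1.
have uniq := commutant_unique g0 g1 ca0.
(* z(y) and y(z) commute with [g] and have the same multiplier, so they coincide. *)
have zcomm y : y 0%N = 0 -> pscommute g y -> pscommute z y.
  move=> y0 gy; apply: uniq.
  - by rewrite pscomp_coef0.
  - by rewrite pscomp_coef0.
  - by rewrite (pscomp_coef1 z y0) (pscomp_coef1 y z0) mulrC.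
  - exact: pscommute_comp gz gy.
  - exact: pscommute_comp gy gz.
have z1_neq0 : z1 != 0 by apply: contra_neq z1n0 => ->; exact: rmorph0.
exists z; split.
- by split; rewrite ?zz1.
- split.
    (* The iterate of order e and x both commute with [g] and have multiplier 1; smaller iterates
       have multiplier different from 1. *)
    apply: uniq (psiter_coef0 _ z0) _ _ (pscommute_iter _ g0 z0 gz) _.
    - by [].
    - by rewrite psiter_coef1 // zz1 z1e.
    - by rewrite /pscommute pscompx (pscompX g0).
  move=> j /z1j; rewrite -zz1 -psiter_coef1 // => zj e.
  by rewrite e eqxx in zj.
(* [z] commutes with both factors of f = W o g. *)
- rewrite /pscommute fE (pscompA z W0 g0) (zcomm W W0 gW) (pscompA' W z0 g0).
  by rewrite -[pscomp z g]gz (pscompA W g0 z0).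
- exact: zcomm.
Qed.
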